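(* Let $\mathcal{H}$ be a Hilbert space, let $S$ be a unital semigroup with involution $\mathfrak{I}$, let $\phi$ be an action of $S$ on a set $X$, and let $K: X\times X\to\mathcal{L}(\mathcal{H})$ be a hermitian kernel on $X$ such that $$K(x,\phi(a,y))=K(\phi(\mathfrak{I}(a),x),y)\quad\text{for all } x,y\in X,\ a\in S.$$ For $x\in X$ and $\xi\in\mathcal{H}$ let $g_{x,\xi}:X\to\mathcal{H}$ be the function $g_{x,\xi}(y)=K(y,x)\xi$. The following assertions are equivalent: (1) There exists $L\in\mathcal{B}_\phi^+(X,\mathcal{H})$ such that $-L\le K\le L$. (2) $K$ has a Kolmogorov decomposition $(V;\mathcal{K})$ with the property that there exists a representation $U$ of $S$ on $\mathcal{K}$ such that $V(\phi(a,x))=U(a)V(x)$ for all $x\in X$, $a\in S$. (3) There exists a Kreĭn space $\mathcal{R}$ such that: (a) $\mathcal{R}\subset\mathcal{F}(X,\mathcal{H})$; (b) the set $\{g_{x,\xi}\mid x\in X,\ \xi\in\mathcal{H}\}$ is total in $\mathcal{R}$; (c) $\langle f(x),\xi\rangle_{\mathcal{H}}=[f,g_{x,\xi}]_{\mathcal{R}}$ for all $f\in\mathcal{R}$, $\xi\in\mathcal{H}$, $x\in X$; (d) there exists a representation $\bar U$ of $S$ on $\mathcal{R}$ such that $(\bar U(a)f)(x)=f(\phi(\mathfrak{I}(a),x))$ for all $a\in S$, $x\in X$ and $f\in\mathcal{R}$.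
   Context: Kreĭn spaces. A Kreĭn space is an indefinite inner product space $(\mathcal{K},[\cdot,\cdot]_{\mathcal{K}})$ for which there is a positive inner product $\langle\cdot,\cdot\rangle$ making $\mathcal{K}$ a Hilbert space and an operator $J$ with $J^*=J^{-1}=J$ (with respect to $\langle\cdot,\cdot\rangle$) such that $[\xi,\eta]=\langle J\xi,\eta\rangle$; such a $J$ is called a fundamental symmetry. Topological notions (boundedness, totality) refer to the Hilbert space topology, and $*$ denotes the Hilbert space adjoint. $\mathcal{L}(\mathcal{H},\mathcal{K})$ is the set of bounded linear operators, $\mathcal{L}(\mathcal{H})=\mathcal{L}(\mathcal{H},\mathcal{H})$. A set is total if its linear span is dense. Kernels. A kernel on $X$ with values in $\mathcal{L}(\mathcal{H})$ is a map $K:X\times X\to\mathcal{L}(\mathcal{H})$; it is hermitian if $K(x,y)=K(y,x)^*$ for all $x,y$. $\mathcal{F}(X,\mathcal{H})$ is the space of all functions $X\to\mathcal{H}$, and $\mathcal{F}_0(X,\mathcal{H})$ the subspace of those vanishing except at finitely many points. For $f,g\in\mathcal{F}_0(X,\mathcal{H})$ put $[f,g]_K=\sum_{x,y\in X}\langle K(x,y)f(y),g(x)\rangle$. A hermitian kernel $L$ is positive definite if $[f,f]_L\ge0$ for all $f$. For hermitian kernels $A,B$, $A\le B$ means $[f,f]_A\le[f,f]_B$ for all $f\in\mathcal{F}_0(X,\mathcal{H})$. Kolmogorov decomposition. A Kolmogorov decomposition of a hermitian kernel $K$ is a pair $(V;\mathcal{K})$ where $\mathcal{K}$ is a Kreĭn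 space with fundamental symmetry $J$, $V=\{V(x)\}_{x\in X}\subset\mathcal{L}(\mathcal{H},\mathcal{K})$ satisfies $K(x,y)=V(x)^*JV(y)$ for all $x,y\in X$, and $\{V(x)\mathcal{H}\mid x\in X\}$ is total in $\mathcal{K}$. Actions. An involution on a unital semigroup $S$ is a map $\mathfrak{I}:S\to S$ with $\mathfrak{I}^2=\mathrm{id}$ and $\mathfrak{I}(ab)=\mathfrak{I}(b)\mathfrak{I}(a)$. An action of $S$ on $X$ is a map $\phi:S\times X\to X$ with $\phi(ab,x)=\phi(a,\phi(b,x))$ and with the unit acting as the identity. A representation of $S$ on a Kreĭn space $\mathcal{K}$ is a unital multiplicative map $U:S\to\mathcal{L}(\mathcal{K})$. For $a\in S$, let $\psi_a:\mathcal{F}_0(X,\mathcal{H})\to\mathcal{F}_0(X,\mathcal{H})$ be the linear map with $\psi_a(\xi_x)=\xi_{\phi(a,x)}$, where $\xi_x$ is the function equal to $\xi\in\mathcal{H}$ at $x$ and $0$ elsewhere. A positive definite kernel $L$ is $\phi$-bounded if for every $a\in S$ the map $\psi_a$ is bounded with respect to the seminorm $f\mapsto[f,f]_L^{1/2}$. $\mathcal{B}_\phi^+(X,\mathcal{H})$ is the set of positive definite $\phi$-bounded kernels on $X$ with values in $\mathcal{L}(\mathcal{H})$. *)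

(* Defs.v *)
From HB Require Import structures.
From mathcomp Require Import all_boot all_order all_algebra.
From mathcomp Require Import mathcomp_extra boolp classical_sets functions.
From mathcomp Require Import cardinality fsbigop reals topology normedtype.
From mathcomp Require Import complex.

Set Implicit Arguments.
Unset Strict Implicit.
Unset Printing Implicit Defensive.

Import Order.TTheory GRing.Theory Num.Theory.
Import numFieldNormedType.Exports.

Local Open Scope classical_set_scope.
Local Open Scope ring_scope.

(* The scalars are a [numClosedFieldType] [C]; complex Hilbert spaces are the
   case [C := R[i]] with [R : realType]. Inner products are linear in the first
   argument and conjugate-linear in the second. *)

HB.mixin Record NormedModule_isHilbert (C : numClosedFieldType) V
    & CompleteNormedModule C V := {
  hdot : {dot V for (@Num.conj C)};
  hdotxx : forall x : V, hdot x x = `|x| ^+ 2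
}.

#[short(type="hilbertType")]
HB.structure Definition Hilbert (C : numClosedFieldType) :=
  {V of CompleteNormedModule C V & NormedModule_isHilbert C V}.

HB.mixin Record isBoundedOp (C : numClosedFieldType) (V W : normedModType C)
    (f : V -> W) := {
  boundedop_subproof : bounded_near f (nbhs (0 : V))
}.

#[short(type="boundedOp")]
HB.structure Definition BoundedOp (C : numClosedFieldType)
    (V W : normedModType C) :=
  {f of @GRing.Linear C V W *:%R f & isBoundedOp C V W f}.

(* [adjoint A y] is the vector [z] with [<A x, y> = <x, z>] for all [x]; it is
   unique, and it exists for every bounded operator [A] (Riesz). *)
Definition adjoint (C : numClosedFieldType) (V W : hilbertType C) (A : V -> W)
  (y : W) : V := get [set z | forall x, hdot (A x) y = hdot x z].

(* A Krein space together with a fundamental symmetry [fsym]. The underlying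
   Hilbert structure, which carries the topology, is that of the positive inner
   product [hdot]; the indefinite inner product is [kdot] below. *)
HB.mixin Record Hilbert_isKrein (C : numClosedFieldType) V & Hilbert C V := {
  fsym : boundedOp V V;
  fsym_adjoint : adjoint fsym =1 fsym;
  fsymK : involutive fsym
}.

#[short(type="kreinType")]
HB.structure Definition Krein (C : numClosedFieldType) :=
  {V of Hilbert C V & Hilbert_isKrein C V}.

Definition kdot (C : numClosedFieldType) (V : kreinType C) (x y : V) : C :=
  hdot (fsym x) y.

(* Krein spaces whose vectors are the elements of a linear subspace [D] of [W],
   with the linear operations of [W]; no compatibility with a topology on [W]
   is required. *)
#[short(type="subKreinType")]
HB.structure Definition SubKrein (C : numClosedFieldType) (W : lmodType C)
    (D : pred W) :=
  {V of @GRing.SubLmodule C W D V & Krein C V}.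

Section Total.
Context {C : numClosedFieldType} {V : normedModType C}.

Definition lin_span (A : set V) : set V :=
  [set v | exists n (c : 'I_n -> C) (w : 'I_n -> V),
     (forall i, A (w i)) /\ v = \sum_(i < n) c i *: w i].

Definition total_set (A : set V) := dense (lin_span A).
End Total.

Section OppBoundedOp.
Context {C : numClosedFieldType} {V W : normedModType C}.
Variable f : boundedOp V W.

Lemma opp_bounded_subproof : bounded_near (\- f) (nbhs (0 : V)).
Proof.
have := @boundedop_subproof _ _ _ f; rewrite /bounded_near.
by apply: filterS => M; apply: filterS => x /=; rewrite normrN.
Qed.

HB.instance Definition _ :=
  isBoundedOp.Build C V W (\- f) opp_bounded_subproof.
End OppBoundedOp.

Section Kernels.
Context {C : numClosedFieldType} {H : hilbertType C} {X : choiceType}.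

Definition opkernel := X -> X -> boundedOp H H.
Implicit Types K L A B : opkernel.

Definition hermitian_kernel K := forall x y, K x y =1 adjoint (K y x).

Definition opp_kernel K : opkernel := fun x y => (\- (K x y) : H -> H).

Definition fin_supp (f : X -> H) := finite_set [set x | f x != 0].

Definition kernel_form K (f g : X -> H) : C :=
  \sum_(x \in [set: X]) \sum_(y \in [set: X]) hdot (K x y (f y)) (g x).

Definition posdef_kernel L :=
  hermitian_kernel L /\ forall f, fin_supp f -> 0 <= kernel_form L f f.

Definition le_kernel A B :=
  forall f, fin_supp f -> kernel_form A f f <= kernel_form B f f.

Definition kernel_seminorm L (f : X -> H) : C := sqrtC (kernel_form L f f).

Definition single (x : X) (xi : H) : X -> H :=
  fun y => if y == x then xi else 0.

(* The linear map on finitely supported functions that sends [single x xi] to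
   [single (phi a x) xi]. *)
Definition push {S : Type} (phi : S -> X -> X) (a : S) (f : X -> H) : X -> H :=
  \sum_(x \in [set: X]) single (phi a x) (f x).

Definition action_bounded {S : Type} (phi : S -> X -> X) L :=
  forall a, exists2 c : C, 0 <= c & forall f, fin_supp f ->
    kernel_seminorm L (push phi a f) <= c * kernel_seminorm L f.

Definition posdef_bounded {S : Type} (phi : S -> X -> X) L :=
  posdef_kernel L /\ action_bounded phi L.

Definition kernel_section K (x : X) (xi : H) : X -> H := fun y => K y x xi.

Definition kolmogorov_decomposition K (KK : kreinType C)
    (V : X -> boundedOp H KK) :=
  (forall x y xi, K x y xi = adjoint (V x) (fsym (V y xi))) /\
  total_set (\bigcup_x range (V x)).
End Kernels.
Arguments opkernel {C} H X.

Definition is_action (S : monoidType) (X : Type) (phi : S -> X -> X) :=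
  (forall x, phi 1%g x = x) /\
  (forall a b x, phi (a * b)%g x = phi a (phi b x)).

Definition is_representation (C : numClosedFieldType) (S : monoidType)
    (KK : kreinType C) (U : S -> boundedOp KK KK) :=
  (forall v, U 1%g v = v) /\ (forall a b v, U (a * b)%g v = U a (U b v)).

(* Main.v *)
From HB Require Import structures.
Require Import Defs.
From mathcomp Require Import all_boot all_order all_algebra.
From mathcomp Require Import boolp classical_sets functions.
From mathcomp Require Import cardinality fsbigop reals topology normedtype sequences.
From mathcomp Require Import complex.
From mathcomp Require Import ring lra.

(** Each implication is a construction.

    From a majorant [L] to a Kolmogorov decomposition. Complete the finitely
    supported functions for the form of [L] to a Hilbert space [E]. Since
    [-L <= K <= L], the form of [K] is [<G f, g>] for a selfadjoint contraction
    [G] of [E] ([dominated_cauchy] and Riesz). Put [|G|] for the square root of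
    [G ^ 2], a limit of an explicit iteration ([abs_exists]), and let [S] be the
    sign of [G] ([sign_exists]). The completion of [E] for [<|G| x, y>], with the
    symmetry induced by [S], is a Krein space whose indefinite inner product
    restricts to [<G x, y>] ([krein_induced]). The shifts of functions induced by
    the action are bounded on [E] since [L] is bounded for the action, and the
    invariance of [K] says that the shifts by [a] and its involute are adjoint
    for [<G x, y>]. An operator with such an adjoint is bounded for the weaker
    norm of [|G|], by Reid's inequality ([reid]), and this gives the
    representation.

    From a Kolmogorov decomposition [(V; KK)] to a reproducing kernel space. A
    vector [k] becomes the function with value [V(x)^* J k] at [x]; by
    totality this map is injective, and its range takes over the Krein structure
    ([krange], [reproducing_space]).

    From a reproducing kernel space to a majorant. Take for [L] the Gram kernel
    of the kernel sections with respect to the Hilbert inner product. The operator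
    [L x y] has the everywhere defined adjoint [L y x], hence is bounded
    ([hellinger_toeplitz], [reproducing_majorant]).

    Inner products enter through their real parts [rdot], and the norm through
    its real value [hn], which keeps all estimates in the ordered field [R].
    Adjoints and extensions of bounded operators all come from one variational
    form of Riesz's theorem ([riesz]), and Hilbert spaces from completions of
    semi-inner products ([completion_exists]). *)

Set Implicit Arguments.
Unset Strict Implicit.
Unset Printing Implicit Defensive.

Import Order.TTheory GRing.Theory Num.Theory.
Import numFieldNormedType.Exports.

Local Open Scope classical_set_scope.
Local Open Scope ring_scope.
Local Open Scope complex_scope.

(* [ssrfun.fsym] would otherwise hide the fundamental symmetry. *)
Local Notation fsym := Defs.fsym.

(** * Real inner products on complex spaces *)

Lemma harmonic_small (R : realType) (e : R) : 0 < e ->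
  exists n0, forall n, (n0 <= n)%N -> n.+1%:R^-1 < e.
Proof.
move=> e0; have /cvgrPdist_lt/(_ e e0)[n0 _ h] := @cvg_harmonic R.
by exists n0 => n /h; rewrite /= sub0r normrN ger0_norm// invr_ge0.
Qed.

Lemma cvg_seq_unique (R : realType) (s : nat -> R) (a b : R) :
  s n @[n --> \oo] --> a -> s n @[n --> \oo] --> b -> a = b.
Proof. exact: cvg_unique. Qed.

Lemma cvg_to_eps (R : realType) (a : nat -> R) (l : R) :
  (forall e, 0 < e -> exists n0, forall n, (n0 <= n)%N -> `|a n - l| < e) ->
  a n @[n --> \oo] --> l.
Proof.
move=> h; apply/cvgrPdist_lt => e e0; have [n0 hn0] := h e e0.
by exists n0 => // n /hn0; rewrite distrC.
Qed.

Lemma cvg_eps (R : realType) (a : nat -> R) (l : R) : a n @[n --> \oo] --> l ->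
  forall e, 0 < e -> exists n0, forall n, (n0 <= n)%N -> `|a n - l| < e.
Proof.
move=> /cvgrPdist_lt h e e0; have [n0 _ hn0] := h e e0.
by exists n0 => n /hn0; rewrite /= distrC.
Qed.

(** The real part of a positive semidefinite sesquilinear form. It determines
    the form, see [cdot], and estimates on it take place in the ordered field
    [R] rather than in [R[i]]; complex linearity is encoded by the invariance
    under multiplication by the imaginary unit. *)
Record semidot (R : realType) (V : lmodType R[i]) (q : V -> V -> R) : Prop :=
  Semidot {
    sdC : forall x y, q x y = q y x;
    sdDl : forall x y z, q (x + y) z = q x z + q y z;
    sdZl : forall (a : R) x y, q (a%:C *: x) y = a * q x y;
    sdii : forall x y, q ('i *: x) ('i *: y) = q x y;
    sd_ge0 : forall x, 0 <= q x x
  }.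

Definition snorm (R : realType) (V : lmodType R[i]) (q : V -> V -> R) (x : V) :=
  Num.sqrt (q x x).

Section SemidotTheory.
Variables (R : realType) (V : lmodType R[i]) (q : V -> V -> R).
Hypothesis qd : semidot q.
Local Notation "'[ x , y ]" := (q x y).
Local Notation N := (snorm q).
Implicit Types (x y z : V).

Lemma sdDr x y z : '[z, x + y] = '[z, x] + '[z, y].
Proof. by rewrite (sdC qd) (sdDl qd) !(sdC qd z). Qed.
Lemma sdZr (a : R) x y : '[x, a%:C *: y] = a * '[x, y].
Proof. by rewrite (sdC qd) (sdZl qd) (sdC qd x). Qed.
Lemma sdNl x y : '[- x, y] = - '[x, y].
Proof. by rewrite -scaleN1r -[X in X *: x](rmorphN1 (real_complex R)) (sdZl qd) mulN1r. Qed.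
Lemma sdNr x y : '[x, - y] = - '[x, y].
Proof. by rewrite (sdC qd) sdNl (sdC qd x). Qed.
Lemma sdBl x y z : '[x - y, z] = '[x, z] - '[y, z].
Proof. by rewrite (sdDl qd) sdNl. Qed.
Lemma sdBr x y z : '[z, x - y] = '[z, x] - '[z, y].
Proof. by rewrite sdDr sdNr. Qed.
Lemma sd0l x : '[0, x] = 0.
Proof. by rewrite -(subrr x) sdBl subrr. Qed.
Lemma sd0r x : '[x, 0] = 0.
Proof. by rewrite (sdC qd) sd0l. Qed.
Lemma sd_suml (I : Type) (s : seq I) (F : I -> V) x :
  '[\sum_(i <- s) F i, x] = \sum_(i <- s) '[F i, x].
Proof. by elim/big_rec2: _ => [|i a b _ <-]; rewrite ?sd0l// (sdDl qd). Qed.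
Lemma sd_il x y : '['i *: x, y] = - '[x, 'i *: y].
Proof.
rewrite -(sdii qd) scalerA -expr2 sqr_i scaleN1r sdNl.
by [].
Qed.
Lemma sd_ix x : '[x, 'i *: x] = 0.
Proof. have := sd_il x x; rewrite (sdC qd); lra. Qed.

Lemma snorm_ge0 x : 0 <= N x. Proof. exact: sqrtr_ge0. Qed.
Lemma snorm_sqr x : N x ^+ 2 = '[x, x].
Proof. by rewrite sqr_sqrtr// (sd_ge0 qd). Qed.

Lemma sd_cauchy x y : `|'[x, y]| <= N x * N y.
Proof.
rewrite -(@ler_pXn2r _ 2)// ?nnegrE ?mulr_ge0 ?snorm_ge0//.
rewrite exprMn !snorm_sqr real_normK ?num_real//.
have key (t : R) : 0 <= '[x, x] - 2 * t * '[x, y] + t ^+ 2 * '[y, y].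
  have := sd_ge0 qd (x - t%:C *: y).
  by rewrite sdBl !sdBr (sdZl qd) !sdZr (sdZl qd) (sdC qd y x); lra.
have y0 := sd_ge0 qd y.
(* The optimal [t] is [q x y / q y y]; if [q y y = 0], the affine function of
   [t] is bounded below, so it is constant. *)
have [y0'|y_eq0] : 0 < '[y, y] \/ '[y, y] = 0 by lra.
  have := key ('[x, y] / '[y, y]).
  rewrite (_ : _ + _ = '[x,x] - '[x,y]^+2 / '[y, y]); last by field; rewrite gt_eqF.
  by rewrite subr_ge0 ler_pdivrMr.
rewrite y_eq0 mulr0; have [->|xy0] := eqVneq '[x, y] 0; first by rewrite expr0n.
have := key (('[x, x] + 1) / (2 * '[x, y])); rewrite y_eq0 mulr0 addr0.
rewrite (_ : _ - _ = -1); first lra.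
by field.
Qed.

Lemma sd_le x y : '[x, y] <= N x * N y.
Proof. exact: le_trans (ler_norm _) (sd_cauchy x y). Qed.

Lemma snorm0 : N 0 = 0.
Proof. by rewrite /snorm sd0l sqrtr0. Qed.

Lemma snorm_eq0 x : (N x = 0) <-> '[x, x] = 0.
Proof.
split; last by rewrite /snorm => ->; rewrite sqrtr0.
by move=> x0; rewrite -snorm_sqr x0 expr0n.
Qed.

Lemma snormD x y : N (x + y) <= N x + N y.
Proof.
rewrite -(@ler_pXn2r _ 2)// ?nnegrE ?addr_ge0 ?snorm_ge0//.
rewrite sqrrD !snorm_sqr (sdDl qd) !sdDr (sdC qd y x) mulr2n.
have := sd_le x y; lra.
Qed.

Lemma snormN x : N (- x) = N x.
Proof. by rewrite /snorm sdNl sdNr opprK. Qed.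

Lemma snormB x y : N (x - y) <= N x + N y.
Proof. by rewrite -(snormN y) snormD. Qed.

Lemma snormBC x y : N (x - y) = N (y - x).
Proof. by rewrite -snormN opprB. Qed.

Lemma snorm_tri z x y : N (x - y) <= N (x - z) + N (z - y).
Proof. by rewrite -[x - y](subrK (z - y)) (_ : x - y - (z - y) = x - z) ?snormD// opprB addrA subrK. Qed.

Lemma sd_complexZ (a : R[i]) x y :
  '[a *: x, y] = complex.Re a * '[x, y] + complex.Im a * '['i *: x, y].
Proof.
by rewrite [a in LHS]complexE scalerDl (sdDl qd) (mulrC 'i) -scalerA !(sdZl qd).
Qed.

Lemma snormZ (a : R[i]) x : N (a *: x) = Num.sqrt (complex.Re a ^+ 2 + complex.Im a ^+ 2) * N x.
Proof.
have e : '[a *: x, a *: x] = (complex.Re a ^+ 2 + complex.Im a ^+ 2) * '[x, x].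
  rewrite sd_complexZ (sdC qd x) (sdC qd ('i *: x)) !(sd_complexZ a).
  rewrite (sdii qd) sd_il sd_ix; ring.
by rewrite /snorm e sqrtrM// addr_ge0 ?sqr_ge0.
Qed.

Lemma snormZr (a : R) x : N (a%:C *: x) = `|a| * N x.
Proof. by rewrite snormZ /= expr0n addr0 sqrtr_sqr. Qed.

Definition scauchy (u : nat -> V) := forall e : R, 0 < e ->
  exists n0, forall m n, (n0 <= m)%N -> (n0 <= n)%N -> N (u m - u n) < e.

Definition scvg (u : nat -> V) z := N (u n - z) @[n --> \oo] --> 0.

Lemma scvg_epsP u z : (forall e : R, 0 < e ->
  exists n0, forall n, (n0 <= n)%N -> N (u n - z) < e) -> scvg u z.
Proof.
move=> h; apply/cvgrPdist_lt => e e0; have [n0 hn0] := h e e0.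
exists n0 => // n /= n0n; rewrite sub0r normrN ger0_norm ?snorm_ge0//.
exact: hn0.
Qed.

Lemma scvg_eps u z : scvg u z -> forall e : R, 0 < e ->
  exists n0, forall n, (n0 <= n)%N -> N (u n - z) < e.
Proof.
move=> /cvgrPdist_lt h e e0; have [n0 _ hn0] := h e e0.
exists n0 => n n0n; have := hn0 n n0n => /=.
by rewrite sub0r normrN ger0_norm ?snorm_ge0.
Qed.

Lemma scvg_cauchy u z : scvg u z -> scauchy u.
Proof.
move=> /scvg_eps h e e0; have [n0 hn0] := h (e / 2) (divr_gt0 e0 (ltr0n _ 2)).
exists n0 => m n n0m n0n; have := hn0 m n0m; have := hn0 n n0n.
have := snorm_tri z (u m) (u n); rewrite (snormBC z (u n)); lra.
Qed.

Lemma scvg_dot u z y : scvg u z -> '[u n, y] @[n --> \oo] --> '[z, y].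
Proof.
move=> h; apply/cvgrPdist_lt => e e0.
have Ny : 0 < N y + 1 by have := snorm_ge0 y; lra.
have [n0 hn0] := scvg_eps h (divr_gt0 e0 Ny).
exists n0 => // n /= n0n; rewrite distrC -sdBl.
apply: le_lt_trans (sd_cauchy _ _) _.
have := hn0 n n0n; rewrite ltr_pdivlMr// => hn.
apply: le_lt_trans hn; rewrite ler_wpM2l ?snorm_ge0//; lra.
Qed.

Lemma scauchy_bounded u : scauchy u -> exists2 M, 0 < M & forall n, N (u n) <= M.
Proof.
move=> cu; have [n0 hn0] := cu 1 ltr01.
exists (\sum_(i < n0.+1) N (u i) + 1).
  by rewrite ltr_wpDl// sumr_ge0// => i _; exact: snorm_ge0.
have le i : (i <= n0)%N -> N (u i) <= \sum_(i < n0.+1) N (u i).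
  move=> lei; rewrite (bigD1 (Ordinal (lei : (i < n0.+1)%N)))//= lerDl.
  by rewrite sumr_ge0// => j _; exact: snorm_ge0.
move=> n; have [nn0|n0n] := leqP n n0.
  have := le _ nn0; lra.
have h1 := hn0 n n0 (ltnW n0n) (leqnn _); have h2 := le _ (leqnn n0).
have := snormD (u n - u n0) (u n0); rewrite subrK; lra.
Qed.

End SemidotTheory.

(** * Hilbert spaces from real inner products *)

(** The sesquilinear form, linear on the left, whose real part is [q]. *)
Definition cdot (R : realType) (V : lmodType R[i]) (q : V -> V -> R) (x y : V) :
  R[i] := q x y +i* q x ('i *: y).

Section Cdot.
Variables (R : realType) (V : lmodType R[i]) (q : V -> V -> R).
Hypothesis qd : semidot q.

Lemma cdot_bilinear :
  bilinear_for *%R (Num.conj \; *%R) (cdot q : V -> V -> R[i]).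
Proof.
have sw x y : Num.conj (cdot q y x) = cdot q x y.
  by rewrite /Num.conj /= /cdot /= (sdC qd y x) (sdC qd y) (sd_il qd) opprK.
have lin y : linear_for ( *%R ) ((cdot q : V -> V -> R[i]) ^~ y).
  move=> a u v; rewrite /cdot !(sdDl qd) !(sd_complexZ qd a) !(sd_il qd u).
  rewrite scalerA -expr2 sqr_i scaleN1r (sdNr qd) opprK.
  apply/eqP; rewrite eq_complex; case: a => a b /=.
  apply/andP; split; apply/eqP; ring.
split=> // x a u v.
by rewrite -!(sw x) lin rmorphD rmorphM.
Qed.

Lemma cdot_herm x y : cdot q x y = (-1) ^+ false * Num.conj (cdot q y x).
Proof.
rewrite expr0 mul1r /Num.conj /=.
by rewrite /cdot /= (sdC qd y x) (sdC qd y) (sd_il qd) opprK.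
Qed.

Hypothesis q0 : forall x, q x x = 0 -> x = 0.

Lemma cdot_pos x : x != 0 -> 0 < cdot q x x.
Proof.
move=> x0; rewrite /cdot (sd_ix qd) ltcR lt_neqAle (sd_ge0 qd) andbT eq_sym.
by apply: contra x0 => /eqP/q0 ->.
Qed.

End Cdot.

(** Completeness by Cauchy sequences suffices for filters, because the balls
    of radius [n.+1%:R^-1] form a countable base of the uniformity. *)
Lemma scomplete_filter (R : realType) (V : lmodType R[i]) (q : V -> V -> R)
    (F : set_system V) : semidot q -> ProperFilter F ->
  (forall u, scauchy q u -> exists z, scvg q u z) ->
  (forall e : R, 0 < e -> exists x, F [set y | snorm q (x - y) < e]) ->
  exists z, forall e : R, 0 < e -> F [set y | snorm q (z - y) < e].
Proof.
move=> qd FF qc FC.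
have e0 n : 0 < n.+1%:R^-1 :> R by rewrite invr_gt0 ltr0n.
have /choice[u hu] n := FC _ (e0 n).
have near n m : exists2 x, snorm q (u n - x) < n.+1%:R^-1 &
    snorm q (u m - x) < m.+1%:R^-1.
  by have [x []] := @filter_ex _ _ FF _ (filterI (hu n) (hu m)); exists x.
have small := @harmonic_small R.
have [z /scvg_eps hz] : exists z, scvg q u z.
  apply: qc => e ep.
  have [n0 hn0] := small (e / 2) (divr_gt0 ep (ltr0n _ 2)).
  exists n0 => m n /hn0 em /hn0 en; have [x xm xn] := near m n.
  have {em}xm := lt_trans xm em; have {en}xn := lt_trans xn en.
  have := snorm_tri qd x (u m) (u n).
  rewrite (snormBC qd x); lra.
exists z => e ep; have ep2 : 0 < e / 2 by rewrite divr_gt0.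
have [n1 h1] := small _ ep2; have [n2 h2] := hz _ ep2.
pose n := maxn n1 n2.
have := hu n; apply: filterS => x /= /lt_trans/(_ (h1 n (leq_maxl _ _))).
have := h2 n (leq_maxr _ _); have := snorm_tri qd (u n) z x.
rewrite (snormBC qd z (u n)); lra.
Qed.

(** Norm, topology and complex inner product all derive from the real inner
    product [dotr]. *)
HB.factory Record Lmodule_isHilbert (R : realType) V & GRing.Lmodule R[i] V := {
  dotr : V -> V -> R;
  dotr_semidot : semidot dotr;
  dotr_eq0 : forall x, dotr x x = 0 -> x = 0;
  dotr_complete : forall u, scauchy dotr u -> exists z, scvg dotr u z
}.

HB.builders Context R V & Lmodule_isHilbert R V.

Let norm (x : V) : R[i] := (snorm dotr x)%:C.

Let normD x y : norm (x + y) <= norm x + norm y.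
Proof. by rewrite /norm -rmorphD lecR snormD //; exact: dotr_semidot. Qed.

Let normZ (l : R[i]) x : norm (l *: x) = `|l| * norm x.
Proof.
rewrite /norm (snormZ dotr_semidot) rmorphM; congr (_ * _).
by rewrite normc_def.
Qed.

Let norm_eq0 x : norm x = 0 -> x = 0.
Proof.
by move=> /complexI /(snorm_eq0 dotr_semidot) /dotr_eq0.
Qed.

HB.instance Definition _ := Lmodule_isNormed.Build R[i] V normD normZ norm_eq0.

Let complete (F : set_system V) : ProperFilter F -> cauchy F -> cvg F.
Proof.
move=> FF /cauchyP FC.
have [|z hz] := scomplete_filter dotr_semidot FF dotr_complete.
  move=> e ep; have ec : 0 < e%:C by rewrite ltcR.
  have [x xF] := FC _ ec; exists x; apply: filterS xF => y.
  by rewrite -ball_normE /ball_ /= ltcR.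
apply/cvg_ex; exists z; apply/cvgrPdist_lt => e ep.
have [d ed] : exists d : R, e = d%:C.
  by apply/complex_realP; rewrite gtr0_real.
rewrite ed ltcR in ep; have := hz d ep; apply: filterS => y /=.
by rewrite ed /Num.norm /= ltcR.
Qed.

HB.instance Definition _ := Uniform_isComplete.Build V complete.

Let cd := cdot dotr.
HB.instance Definition _ := bilinear_isBilinear.Build R[i] V V R[i] *%R
  (Num.conj \; *%R) cd (cdot_bilinear dotr_semidot).
HB.instance Definition _ := isHermitianSesquilinear.Build R[i] V false Num.conj cd
  (cdot_herm dotr_semidot).
HB.instance Definition _ := isDotProduct.Build R[i] V cd
  (cdot_pos dotr_semidot dotr_eq0).

Let cdxx (x : V) : cd x x = `|x| ^+ 2.
Proof.
rewrite /cd /cdot (sd_ix dotr_semidot) /Num.norm /= -rmorphXn /=.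
by rewrite (snorm_sqr dotr_semidot).
Qed.

HB.instance Definition _ := NormedModule_isHilbert.Build R[i] V cdxx.

HB.end.

(** * Hilbert spaces and Riesz's theorem *)

Section HilbertBasics.
Variables (R : realType) (E : hilbertType R[i]).
Implicit Types x y z : E.

Definition rdot x y : R := complex.Re (hdot x y).

Lemma rdotE x y : hdot x y = cdot rdot x y.
Proof.
rewrite /cdot /rdot linearZr /= /Num.conj /=.
by case: (hdot x y) => a b; simpc.
Qed.

Lemma rdot_semidot : semidot rdot.
Proof.
split=> [x y|x y z|a x y|x y|x]; rewrite /rdot.
- rewrite hermitian_subproof expr0 mul1r /Num.conj /=.
  by case: (hdot y x).
- by rewrite linearDl /= raddfD.
- by rewrite linearZl_LR /=; case: (hdot x y) => b c /=; rewrite mul0r subr0.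
- rewrite linearZr linearZl_LR /= /Num.conj /=.
  by case: (hdot x y) => b c; simpc.
- rewrite hdotxx; have := exprn_ge0 2 (normr_ge0 x).
  by rewrite lecE => /andP[].
Qed.

Lemma normE x : `|x| = (snorm rdot x)%:C.
Proof.
have [r er] : exists r, `|x| = r%:C by apply/complex_realP; rewrite normr_real.
rewrite er /snorm /rdot hdotxx er -rmorphXn/= sqrtr_sqr.
by rewrite ger0_norm// -lecR -er normr_ge0.
Qed.

Lemma rdot_eq0 x : rdot x x = 0 -> x = 0.
Proof.
move=> /(snorm_eq0 rdot_semidot) x0; apply/eqP; rewrite -normr_eq0 normE x0.
by [].
Qed.

Lemma hilbert_complete (u : nat -> E) : scauchy rdot u -> exists z, scvg rdot u z.
Proof.
move=> cu; have /cauchy_cvg/cvg_ex[z hz] : cauchy (u @ \oo).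
  apply: cauchy_exP => e e0; have [d ed] : exists d : R, e = d%:C.
    by apply/complex_realP; rewrite gtr0_real.
  rewrite ed ltcR in e0; have [n0 hn0] := cu d e0.
  exists (u n0), n0 => // n /= n0n; rewrite -ball_normE /= ed normE ltcR.
  by apply: hn0.
exists z; apply: (scvg_epsP) => e e0.
have ec : 0 < e%:C by rewrite ltcR.
move/cvgrPdist_lt : hz => /(_ _ ec)[n0 _ hn0].
exists n0 => n n0n; have := hn0 n n0n; rewrite /= normE ltcR.
by rewrite (snormBC rdot_semidot).
Qed.

Definition hdense (A : set E) :=
  forall x (e : R), 0 < e -> exists2 a, A a & snorm rdot (x - a) < e.

Lemma hdenseP A : dense A <-> hdense A.
Proof.
split=> [dA x e e0|dA O [x Ox] oO].
  have ec : 0 < e%:C by rewrite ltcR.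
  have [||y [yb Ay]] := dA (ball x e%:C).
  - by exists x; exact: ballxx.
  - exact: ball_open.
  - by exists y => //; move: yb; rewrite -ball_normE /= normE ltcR.
have /nbhs_ballP[e /= e0 eO] : nbhs x O by exact: open_nbhs_nbhs.
have [d ed] : exists d : R, e = d%:C.
  by apply/complex_realP; rewrite gtr0_real.
rewrite ed ltcR in e0; have [a Aa xa] := dA x d e0.
by exists a; split=> //; apply: eO; rewrite -ball_normE /= ed normE ltcR.
Qed.

Lemma hdense_orth A x : hdense A -> (forall a, A a -> rdot x a = 0) -> x = 0.
Proof.
move=> dA xA; apply: rdot_eq0; apply/(snorm_eq0 rdot_semidot).
apply/eqP; rewrite eq_le snorm_ge0 andbT; apply/ler_addgt0Pr => e e0.
rewrite add0r leNgt; apply/negP => ex.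
have [a Aa xa] := dA x e e0.
have := sd_le rdot_semidot x (x - a).
rewrite (sdBr rdot_semidot) (xA a Aa) subr0 -(snorm_sqr rdot_semidot).
have n0 : 0 < snorm rdot x by lra.
rewrite expr2 ler_pM2l//; lra.
Qed.

End HilbertBasics.
Arguments rdot {R E}.
Arguments rdot_semidot {R E}.
Notation hn := (snorm rdot).

Lemma quad_ge0 (R : realType) (d s : R) :
  0 <= s -> (forall t, 0 <= 2 * t * d + t ^+ 2 * s) -> d = 0.
Proof.
move=> s0 /(_ (- d / (s + 1))); have s1 : s + 1 != 0 by rewrite gt_eqF//; lra.
rewrite (_ : _ + _ = - (d ^+ 2 * (s + 2)) / (s + 1) ^+ 2); last by field.
rewrite pmulr_lge0; last by rewrite invr_gt0 exprn_gt0//; lra.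
rewrite oppr_ge0 pmulr_lle0; last lra.
by move=> d2; apply/eqP; rewrite -sqrf_eq0 eq_le d2 sqr_ge0.
Qed.

(** Riesz's theorem, by minimising the quadratic functional
    [|i f|^2 - 2 l f]: the representing vector is the limit of [i] along a
    minimising sequence, which is Cauchy by the parallelogram law. *)
Lemma riesz (R : realType) (F : lmodType R[i]) (E : hilbertType R[i])
    (i : {linear F -> E}) (l : F -> R) (c : R) :
  (forall f g, l (f + g) = l f + l g) ->
  (forall (a : R) f, l (a%:C *: f) = a * l f) ->
  (forall f, l f <= c * hn (i f)) ->
  exists2 z, forall f, l f = rdot (i f) z &
    forall e, 0 < e -> exists f, hn (z - i f) < e.
Proof.
move=> lD lZ lc; have rd := @rdot_semidot R E.
pose Q f := rdot (i f) (i f) - 2 * l f.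
have Qge f : - c ^+ 2 <= Q f.
  rewrite /Q -(snorm_sqr rd); have := lc f; have := sqr_ge0 (hn (i f) - c).
  by rewrite sqrrB; lra.
have hQ : has_inf (range Q).
  split; first by exists (Q 0), 0.
  by exists (- c ^+ 2) => _ [f _ <-].
pose m := inf (range Q).
have mQ f : m <= Q f by apply: ge_inf; [exact: hQ.2|exists f].
have /choice[u hu] n : exists f, Q f < m + n.+1%:R^-1.
  have [|_ [f _ <-] hf] := @inf_adherent _ (range Q) n.+1%:R^-1 _ hQ.
    by rewrite invr_gt0 ltr0n.
  by exists f.
(* Parallelogram law, with [m <= Q] at the midpoint of [u n] and [u k]. *)
have par n k : hn (i (u n) - i (u k)) ^+ 2 <= 2 * (n.+1%:R^-1 + k.+1%:R^-1).
  rewrite (snorm_sqr rd); have := mQ ((2^-1)%:C *: (u n + u k)).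
  move: (n.+1%:R^-1) (k.+1%:R^-1) (hu n) (hu k) => a b.
  rewrite /Q (linearZ_LR i) lZ lD (linearD i) !(sdZl rd) !(sdZr rd).
  rewrite !(sdDl rd) !(sdDr rd) !(sdNl rd) !(sdNr rd) (sdC rd (i (u k))).
  lra.
have small := @harmonic_small R.
have [z hz] : exists z, scvg rdot (fun n => i (u n)) z.
  apply: hilbert_complete => e e0; have e4 : 0 < e ^+ 2 / 4.
    by rewrite divr_gt0 ?exprn_gt0.
  have [n0 hn0] := small _ e4; exists n0 => n k /hn0 hn /hn0 hk.
  rewrite -(@ltr_pXn2r _ 2)// ?nnegrE ?snorm_ge0// ?ltW//.
  move: (par n k) hn hk; move: (n.+1%:R^-1) (k.+1%:R^-1) => a b; lra.
exists z; last first.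
  move=> e e0; have [n0 /(_ n0 (leqnn _))h] := scvg_eps hz e0.
  by exists (u n0); rewrite (snormBC rd).
(* First-order condition at the minimum, in the direction [f]. *)
move=> f; apply/eqP; rewrite eq_sym -subr_eq0; apply/eqP.
apply: (@quad_ge0 _ _ (rdot (i f) (i f))); first exact: (sd_ge0 rd).
move=> t; pose b n := 2 * t * (rdot (i (u n)) (i f) - l f)
  + t ^+ 2 * rdot (i f) (i f) + n.+1%:R^-1.
apply: (@cvgr_to_ge _ \oo _ _ b).
  rewrite -[X in _ --> X]addr0; apply: cvgD; last exact: cvg_harmonic.
  apply: cvgD; last exact: cvg_cst.
  apply: cvgMl_tmp; apply: cvgD; last exact: cvg_cst.
  by rewrite (sdC rd); exact: (scvg_dot rd).
apply: nearW => n; have := mQ (u n + t%:C *: f); have := hu n.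
rewrite /b /Q (linearD i) (linearZ_LR i) lD lZ.
move: (n.+1%:R^-1) => r.
rewrite !(sdDl rd) !(sdDr rd) !(sdZl rd) !(sdZr rd) (sdC rd (i f) (i (u n))).
by lra.
Qed.

(** * Bounded operators and adjoints *)

(** Being in the double orthogonal of the range of [i] makes the representing
    vector unique, hence linear in [l]. *)
Lemma riesz_norm (R : realType) (F : lmodType R[i]) (E : hilbertType R[i])
    (i : {linear F -> E}) (l : F -> R) (c : R) :
  (forall f g, l (f + g) = l f + l g) ->
  (forall (a : R) f, l (a%:C *: f) = a * l f) ->
  0 <= c -> (forall f, l f <= c * hn (i f)) ->
  exists z, [/\ forall f, l f = rdot (i f) z,
    forall y, (forall f, rdot (i f) y = 0) -> rdot z y = 0 & hn z <= c].
Proof.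
move=> lD lZ c0 lc; have rd := @rdot_semidot R E.
have [z lz zcl] := riesz lD lZ lc; exists z; split=> // [y iy|].
  apply/eqP; rewrite -normr_le0; apply/ler_addgt0Pr => e e0.
  have d0 : 0 < hn y + 1 by have := snorm_ge0 rdot y; lra.
  have [f hf] := zcl _ (divr_gt0 e0 d0).
  rewrite -[z](subrK (i f)) (sdDl rd) iy addr0 add0r.
  apply: le_trans (sd_cauchy rd _ _) _; rewrite ltr_pdivlMr// in hf.
  apply: le_trans (ltW hf); apply: ler_wpM2l; rewrite ?snorm_ge0//; lra.
rewrite leNgt; apply/negP => cz.
have e0 : 0 < (hn z - c) / 4 by lra.
have [f hf] := zcl _ e0.
have := snorm_sqr rd z; rewrite -[in rdot z](subrK (i f) z) (sdDl rd) -lz => h.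
have h1 := sd_le rd (z - i f) z; have h2 := lc f.
have h3 := snormB rd z (z - i f); rewrite subKr in h3.
move: h h1 h2 h3 hf; move: (hn z) (hn (z - i f)) (hn (i f)) (snorm_ge0 rdot (z - i f)) cz c0.
move: (rdot _ _) (l f) => r s Z d n d0 cz c0 h h1 h2 h3 hd.
have : Z ^+ 2 <= d * Z + c * (Z + d).
  by rewrite h lerD// (le_trans h2)// ler_wpM2l.
suff : 2 * d * Z <= Z ^+ 2 / 2 - c * Z / 2 /\ c * d <= d * Z by nra.
by split; nra.
Qed.

Section Operators.
Variables (R : realType).
Implicit Types (V W : hilbertType R[i]).

Lemma rdot_conj V (a : R[i]) (x y : V) :
  rdot x (a *: y) = rdot (a^*%C *: x) y.
Proof.
have rd := @rdot_semidot R V.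
rewrite (sdC rd) (sd_complexZ rd a) (sd_complexZ rd a^*%C) (sdC rd y x).
rewrite (sd_il rd y) (sdC rd y).
by case: a => a b /=; ring.
Qed.

Lemma rdot_conjl V (a : R[i]) (x y : V) :
  rdot (a *: x) y = rdot x (a^*%C *: y).
Proof. by rewrite rdot_conj conjcK. Qed.

Lemma rdot_inj V (x x' : V) : (forall y, rdot y x = rdot y x') -> x = x'.
Proof.
move=> h; apply/eqP; rewrite -subr_eq0; apply/eqP/rdot_eq0.
by rewrite (sdBr rdot_semidot) h subrr.
Qed.

Lemma boundedOp_bound V W (A : boundedOp V W) :
  exists2 M, 0 <= M & forall x, hn (A x) <= M * hn x.
Proof.
have /linear_boundedP/pinfty_ex_gt0[M M0 AM] := @boundedop_subproof _ _ _ A.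
have [r er] : exists r : R, M = r%:C by apply/complex_realP; rewrite gtr0_real.
rewrite er ltcR in M0; exists r; first exact: ltW.
by move=> x; have := AM x; rewrite er !normE -rmorphM lecR.
Qed.

Lemma mk_boundedOp V W (f : V -> W) (M : R) : linear f ->
  (forall x, hn (f x) <= M * hn x) -> exists A : boundedOp V W, A =1 f.
Proof.
move=> fl fM; pose lf := GRing.isLinear.Build _ _ _ _ f fl.
pose F : {linear V -> W} := HB.pack f lf.
have bF : bounded_near F (nbhs (0 : V)).
  apply/linear_boundedP; near=> r => x; rewrite !normE.
  apply: (@le_trans _ _ (`|M|%:C * (hn x)%:C)).
    rewrite -rmorphM lecR (le_trans (fM x))// ler_wpM2r ?snorm_ge0//.
    exact: ler_norm.
  apply: ler_wpM2r; first by rewrite lecR snorm_ge0.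
  by near: r; apply: nbhs_pinfty_ge; apply/complex_realP; exists `|M|.
by exists (HB.pack_for (boundedOp V W) f lf (isBoundedOp.Build _ _ _ f bF)).
Unshelve. all: by end_near. Qed.

Lemma adj_ext (F : lmodType R[i]) V W (i : {linear F -> V}) (T : {linear F -> W})
    (c : R) : 0 <= c -> (forall f, hn (T f) <= c * hn (i f)) ->
  exists2 B : boundedOp W V, forall f y, rdot (T f) y = rdot (i f) (B y) &
    forall y, hn (B y) <= c * hn y.
Proof.
move=> c0 Tc; have rd := @rdot_semidot R V; have rd' := @rdot_semidot R W.
have /choice[B hB] y : exists z, [/\ forall f, rdot (T f) y = rdot (i f) z,
    forall y, (forall f, rdot (i f) y = 0) -> rdot z y = 0 & hn z <= c * hn y].
  apply: riesz_norm => [f g|a f||f].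
  - by rewrite linearD (sdDl rd').
  - by rewrite linearZ (sdZl rd').
  - by rewrite mulr_ge0 ?snorm_ge0.
  - rewrite (le_trans (sd_le rd' _ _))// mulrAC ler_wpM2r ?snorm_ge0//.
have Bl : linear B.
  move=> a x y; have [hx hx' _] := hB x; have [hy hy' _] := hB y.
  have [h h' _] := hB (a *: x + y).
  apply/eqP; rewrite -subr_eq0; apply/eqP/rdot_eq0.
  set w := _ - _ ; have wi f : rdot (i f) w = 0.
    rewrite /w (sdBr rd) -h !sdDr// !rdot_conj -!linearZ /= -hx -hy.
    by rewrite linearZ subrr.
  have wy v : (forall f, rdot (i f) v = 0) -> rdot w v = 0.
    move=> hv; rewrite /w (sdBl rd) (sdDl rd) h'// hy'// sub0r addr0.
    rewrite -[a]conjcK -rdot_conj hx' ?oppr0// => f.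
    by rewrite rdot_conj conjcK -linearZ.
  exact: wy.
have [A hA] := mk_boundedOp Bl (fun y => let: And3 _ _ h := hB y in h).
by exists A => [f|] y; rewrite hA; have [] := hB y.
Qed.

Lemma adj_exists V W (A : boundedOp V W) :
  exists B : boundedOp W V, forall x y, rdot (A x) y = rdot x (B y).
Proof.
have [M M0 AM] := boundedOp_bound A.
by have [B hB _] := @adj_ext V V W (@idfun V) A M M0 AM; exists B.
Qed.

(** The map [i f -> T f] has an adjoint defined everywhere, by Riesz's theorem,
    and its extension is the adjoint of that adjoint. It vanishes on the
    orthogonal complement of the range of [i]. *)
Lemma op_ext (F : lmodType R[i]) V W (i : {linear F -> V}) (T : {linear F -> W})
    (c : R) : 0 <= c -> (forall f, hn (T f) <= c * hn (i f)) ->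
  exists2 A : boundedOp V W, forall f, A (i f) = T f &
    forall x, hn (A x) <= c * hn x.
Proof.
move=> c0 Tc; have [B hB Bc] := adj_ext c0 Tc; have [A hA] := adj_exists B.
exists A => [f|x]; last first.
  have h := snorm_sqr rdot_semidot (A x); rewrite -hA in h.
  have := sd_le rdot_semidot (B (A x)) x; rewrite -h.
  move: (Bc (A x)) (snorm_ge0 rdot (A x)) (snorm_ge0 rdot x).
  move: {h} (hn (A x)) (hn (B (A x))) (hn x) => a b d h1 a0 d0 h2.
  have h3 : a ^+ 2 <= a * (c * d) by nra.
  have cd : 0 <= c * d by rewrite mulr_ge0.
  by rewrite leNgt; apply/negP => lt; nra.
apply: rdot_inj => y.
by rewrite -hA (sdC rdot_semidot) -hB (sdC rdot_semidot).
Qed.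

Lemma hdot_rdot V W (f : {linear V -> W}) (g : W -> V) :
  (forall x y, rdot (f x) y = rdot x (g y)) ->
  forall x y, hdot (f x) y = hdot x (g y).
Proof.
by move=> h x y; rewrite !rdotE /cdot -h !rdot_conj -h linearZ.
Qed.

Lemma adjointE V W (A : boundedOp V W) y z :
  (forall x, rdot (A x) y = rdot x z) -> adjoint A y = z.
Proof.
move=> h; have hz : forall x, hdot (A x) y = hdot x z.
  have [B hB] := adj_exists A.
  suff -> : z = B y by move=> x; exact: (@hdot_rdot _ _ A B hB).
  by apply: rdot_inj => x; rewrite -h hB.
apply: rdot_inj => x; rewrite /rdot.
have e : hdot (A x) y = hdot x (adjoint A y).
  exact: (@getPex _ [set z | forall x, hdot (A x) y = hdot x z] (ex_intro _ z hz) x).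
by rewrite -e hz.
Qed.

Lemma adjointP V W (A : boundedOp V W) x y : rdot (A x) y = rdot x (adjoint A y).
Proof.
have [B hB] := adj_exists A.
by rewrite (@adjointE _ _ A y (B y)).
Qed.

End Operators.

(** * Completion of a space with a semi-inner product *)

Section CauchyDot.
Variables (R : realType) (F : lmodType R[i]) (q : F -> F -> R).
Hypothesis qd : semidot q.

Lemma scauchy_cst x : scauchy q (fun=> x).
Proof.
move=> e e0; exists 0%N => m n _ _; rewrite subrr.
by rewrite /snorm (sd0l qd) sqrtr0.
Qed.

Lemma scauchy_lin (a : R[i]) u v : scauchy q u -> scauchy q v ->
  scauchy q (fun n => a *: u n + v n).
Proof.
move=> cu cv e e0; set r := Num.sqrt (complex.Re a ^+ 2 + complex.Im a ^+ 2).
have r0 : 0 <= r by exact: sqrtr_ge0.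
have r1 : 0 < 2 * (r + 1) by lra.
have [n1 h1] := cu _ (divr_gt0 e0 r1).
have [n2 h2] := cv _ (divr_gt0 e0 (ltr0n _ 2)).
exists (maxn n1 n2) => m n; rewrite !geq_max => /andP[m1 m2] /andP[n1' n2'].
rewrite opprD addrACA -scalerBr.
have := snormD qd (a *: (u m - u n)) (v m - v n).
rewrite (snormZ qd) -/r; have := h2 _ _ m2 n2'; have := h1 _ _ m1 n1'.
rewrite ltr_pdivlMr//; have := snorm_ge0 q (u m - u n).
move: (snorm _ _) (snorm _ _) (snorm _ _) => A B D; nra.
Qed.

Lemma scauchyB u v : scauchy q u -> scauchy q v -> scauchy q (fun n => u n - v n).
Proof.
move=> cu cv; have := scauchy_lin (-1) cv cu.
by under eq_fun do rewrite scaleN1r addrC.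
Qed.

Lemma scauchy_dot u v : scauchy q u -> scauchy q v ->
  cvg (q (u n) (v n) @[n --> \oo]).
Proof.
move=> cu cv; have [M M0 uM] := scauchy_bounded qd cu.
have [M' M'0 vM] := scauchy_bounded qd cv.
apply: cauchy_cvg; apply: cauchy_exP => e e0.
have e1 : 0 < e / (2 * M) by rewrite divr_gt0// mulr_gt0.
have e2 : 0 < e / (2 * M') by rewrite divr_gt0// mulr_gt0.
have [n1 h1] := cu _ e2; have [n2 h2] := cv _ e1.
pose m := maxn n1 n2; exists (q (u m) (v m)), m => // n /=.
rewrite geq_max => /andP[n1n n2n]; rewrite -ball_normE /=.
have -> : q (u m) (v m) - q (u n) (v n) =
    q (u m - u n) (v m) + q (u n) (v m - v n).
  by rewrite (sdBl qd) (sdBr qd); ring.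
have := ler_normD (q (u m - u n) (v m)) (q (u n) (v m - v n)).
have := sd_cauchy qd (u m - u n) (v m).
have := sd_cauchy qd (u n) (v m - v n).
have := h1 _ _ (leq_maxl n1 n2) n1n; have := h2 _ _ (leq_maxr n1 n2) n2n.
rewrite !ltr_pdivlMr ?mulr_gt0// -/m.
have := snorm_ge0 q (u m - u n); have := snorm_ge0 q (v m - v n).
have := snorm_ge0 q (u n); have := snorm_ge0 q (v m).
have := uM n; have := vM m.
move: (snorm q _) (snorm q _) (snorm q _) (snorm q _) => A B D G.
move: (`| _ |) (`| _ |) (`| _ |) => a b d; nra.
Qed.

(** Taking [v := u] shows that a Cauchy sequence is determined up to null
    sequences by its weak limit: this is why the completion can be made of weak
    limits. Past some [n1] the vector [v n] may be replaced by the fixed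
    [v n1]. *)
Lemma scauchy_dot0 u v : scauchy q u -> scauchy q v ->
  (forall h, q (u n) h @[n --> \oo] --> 0) ->
  q (u n) (v n) @[n --> \oo] --> 0.
Proof.
move=> cu cv u0; have [M M0 uM] := scauchy_bounded qd cu.
apply: cvg_to_eps => e e0.
have e1 : 0 < e / (2 * M) by rewrite divr_gt0// mulr_gt0.
have e2 : 0 < e / 2 by rewrite divr_gt0.
have [n1 h1] := cv _ e1; have [n2 h2] := cvg_eps (u0 (v n1)) e2.
exists (maxn n1 n2) => n; rewrite geq_max => /andP[n1n n2n].
rewrite subr0.
have -> : q (u n) (v n) = q (u n) (v n1) + q (u n) (v n - v n1).
  by rewrite (sdBr qd); ring.
have := ler_normD (q (u n) (v n1)) (q (u n) (v n - v n1)).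
have := h2 _ n2n; rewrite subr0; have := h1 _ _ n1n (leqnn _).
have := sd_cauchy qd (u n) (v n - v n1).
rewrite ltr_pdivlMr ?mulr_gt0//.
have := snorm_ge0 q (v n - v n1); have := snorm_ge0 q (u n); have := uM n.
move: (snorm q _) (snorm q _) => A B.
move: (`| _ |) (`| _ |) (`| _ |) => a b d; nra.
Qed.

End CauchyDot.

Section Completion.
Variables (R : realType) (F : lmodType R[i]) (q : F -> F -> R).

(** [f] is the weak limit of [cdot q (u n)], given by real and imaginary
    parts. *)
Definition represents (u : nat -> F) (f : F -> R[i]) :=
  forall h, (q (u n) h @[n --> \oo] --> complex.Re (f h)) /\
            (q (u n) ('i *: h) @[n --> \oo] --> complex.Im (f h)).

Definition completion_pred : pred (F -> R[i]) :=
  fun f => `[< exists2 u, scauchy q u & represents u f >].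

Hypothesis qd : semidot q.

Lemma represents_lin (a : R[i]) u v f g : represents u f -> represents v g ->
  represents (fun n => a *: u n + v n) (a *: f + g).
Proof.
move=> uf vg h.
have e1 n k : q (a *: u n + v n) k =
    complex.Re a * q (u n) k - complex.Im a * q (u n) ('i *: k) + q (v n) k.
  by rewrite (sdDl qd) (sd_complexZ qd) (sd_il qd); ring.
rewrite !fctE /=; have [uf1 uf2] := uf h; have [vg1 vg2] := vg h.
have -> : complex.Re (a * f h + g h) = complex.Re a * complex.Re (f h)
    - complex.Im a * complex.Im (f h) + complex.Re (g h).
  by case: a {e1} (f h) (g h) => a b [c d] [e k].
have -> : complex.Im (a * f h + g h) = complex.Re a * complex.Im (f h)
    - complex.Im a * - complex.Re (f h) + complex.Im (g h).
  by case: a {e1} (f h) (g h) => a b [c d] [e k] /=; ring.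
split; under eq_cvg do rewrite e1.
  apply: cvgD => //; apply: cvgB; exact: cvgMl_tmp.
apply: cvgD => //; apply: cvgB; apply: cvgMl_tmp => //.
under eq_cvg do rewrite scalerA -expr2 sqr_i scaleN1r (sdNr qd).
exact: cvgN.
Qed.

Lemma represents_sub u v f : represents u f -> represents v f ->
  forall h, q (u n - v n) h @[n --> \oo] --> 0.
Proof.
move=> uf vf h; have := cvgB (uf h).1 (vf h).1; rewrite subrr => H.
suff -> : (fun n => q (u n - v n) h) = (fun n => q (u n) h - q (v n) h) by exact: H.
by apply/funext => n; rewrite (sdBl qd).
Qed.

Lemma represents_cdot f : represents (fun=> f) (cdot q f).
Proof. by move=> h; split; exact: cvg_cst. Qed.

Lemma completion_closed : subsemimod_closed completion_pred.
Proof.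
split; [split|].
- apply/asboolP; exists (fun=> 0); first exact: scauchy_cst.
  move=> h; rewrite !(sd0l qd); split; exact: cvg_cst.
- move=> f g /asboolP[u cu uf] /asboolP[v cv vg].
  apply/asboolP; exists (fun n => 1 *: u n + v n); first exact: scauchy_lin.
  by rewrite -[f]scale1r; exact: represents_lin.
- move=> a f /asboolP[u cu uf].
  apply/asboolP; exists (fun n => a *: u n + 0).
    by apply: scauchy_lin => //; exact: scauchy_cst.
  rewrite -[_ *: f]addr0; apply: represents_lin => //.
  by move=> h; rewrite !(sd0l qd); split; exact: cvg_cst.
Qed.

End Completion.

(** Points of the completion are functionals on [F], the weak limits of Cauchy
    sequences, so that the linear operations are pointwise. *)
Definition completion (R : realType) (F : lmodType R[i]) (q : F -> F -> R)
  (qd : semidot q) := {f : F -> R[i] | completion_pred q f}.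

Section CompletionHilbert.
Variables (R : realType) (F : lmodType R[i]) (q : F -> F -> R).
Hypothesis qd : semidot q.

HB.instance Definition _ := GRing.isSubmodClosed.Build R[i] (F -> R[i])
  (completion_pred q) (completion_closed qd).
HB.instance Definition _ := SubChoice.on (completion qd).
HB.instance Definition _ := [SubChoice_isSubLmodule of completion qd by <:].

Implicit Types f g : completion qd.

Let val_lin (a : R[i]) f g : val (a *: f + g) = a *: val f + val g.
Proof. exact: linearP. Qed.

Definition approx f : nat -> F := projT1 (cid2 (asboolW (valP f))).

Lemma approx_cauchy f : scauchy q (approx f).
Proof. by rewrite /approx; case: cid2. Qed.

Lemma approxP f : represents q (approx f) (val f).
Proof. by rewrite /approx; case: cid2. Qed.

Definition completion_dot f g : R :=
  lim (q (approx f n) (approx g n) @[n --> \oo]).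

Lemma represents_dot u v f g :
  scauchy q u -> represents q u (val f) -> scauchy q v -> represents q v (val g) ->
  q (u n) (v n) @[n --> \oo] --> completion_dot f g.
Proof.
move=> cu uf cv vg.
have cs := approx_cauchy f; have sf := approxP f.
have ct := approx_cauchy g; have tg := approxP g.
rewrite (_ : (fun n => q (u n) (v n)) = (fun n => q (approx f n) (approx g n) +
  (q (u n - approx f n) (v n) + q (v n - approx g n) (approx f n)))); last first.
  apply/funext => n; rewrite !(sdBl qd) (sdC qd (v n)) (sdC qd (approx g n)); ring.
rewrite -[completion_dot f g]addr0; apply: cvgD; first exact: scauchy_dot.
rewrite -[0]addr0; apply: cvgD; apply: scauchy_dot0 => //.
- exact: scauchyB.
- exact: represents_sub uf sf.
- exact: scauchyB.
- exact: represents_sub vg tg.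
Qed.

Lemma approx_dot f g :
  q (approx f n) (approx g n) @[n --> \oo] --> completion_dot f g.
Proof. by apply: represents_dot; (exact: approx_cauchy || exact: approxP). Qed.

Lemma represents_val_lin (a : R[i]) f g : represents q
  (fun n => a *: approx f n + approx g n) (val (a *: f + g)).
Proof. rewrite val_lin; apply: represents_lin => //; exact: approxP. Qed.

Lemma completion_dot_lin (a : R[i]) f g h :
  q (a *: approx f n + approx g n) (approx h n) @[n --> \oo] -->
  completion_dot (a *: f + g) h.
Proof.
apply: represents_dot; [|exact: represents_val_lin| |exact: approxP].
  by apply: scauchy_lin => //; exact: approx_cauchy.
exact: approx_cauchy.
Qed.

Lemma represents0 : represents q (fun=> 0) (val (0 : completion qd)).
Proof. by move=> h; rewrite !(sd0l qd) raddf0; split; exact: cvg_cst. Qed.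

Lemma represents_scale (a : R[i]) f : represents q
  (fun n => a *: approx f n) (val (a *: f)).
Proof.
rewrite -[a *: f]addr0 val_lin; under eq_fun do rewrite -[_ *: approx _ _]addr0.
by apply: represents_lin => //; [exact: approxP|exact: represents0].
Qed.

Lemma scale_cauchy (a : R[i]) f : scauchy q (fun n => a *: approx f n).
Proof.
under eq_fun do rewrite -[_ *: approx _ _]addr0.
by apply: scauchy_lin => //; [exact: approx_cauchy|exact: scauchy_cst].
Qed.

Lemma completion_semidot : semidot completion_dot.
Proof.
split.
- move=> f g; refine (@cvg_seq_unique _ _ _ _ (@approx_dot f g) _).
  by under eq_fun do rewrite (sdC qd); exact: approx_dot.
- move=> f g h; rewrite -[f in LHS]scale1r.
  refine (@cvg_seq_unique _ _ _ _ (@completion_dot_lin 1 f g h) _).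
  under eq_fun do rewrite scale1r (sdDl qd).
  by apply: cvgD; exact: approx_dot.
- move=> a f g; refine (@cvg_seq_unique _ (fun n => q (a%:C *: approx f n) (approx g n)) _ _ _ _).
    apply: represents_dot; [exact: scale_cauchy|exact: represents_scale| |].
      exact: approx_cauchy.
    exact: approxP.
  by under eq_fun do rewrite (sdZl qd); apply: cvgMl_tmp; exact: approx_dot.
- move=> f g; refine (@cvg_seq_unique _ (fun n => q ('i *: approx f n) ('i *: approx g n)) _ _ _ _).
    by apply: represents_dot; (exact: scale_cauchy || exact: represents_scale).
  by under eq_fun do rewrite (sdii qd); exact: approx_dot.
- move=> f; apply: cvgr_to_ge (@approx_dot f f) _.
  by apply: nearW => n; exact: (sd_ge0 qd).
Qed.

Lemma completion_dot_eq0 f : completion_dot f f = 0 -> f = 0.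
Proof.
move=> f0; apply/val_inj; apply/funext => h; rewrite raddf0.
have key k : q (approx f n) k @[n --> \oo] --> 0.
  apply: cvg_to_eps => e e0; have k0 : 0 < snorm q k + 1.
    by have := snorm_ge0 q k; lra.
  have e2 : 0 < (e / (snorm q k + 1)) ^+ 2 by rewrite exprn_gt0// divr_gt0.
  have := @approx_dot f f; rewrite f0 => /cvg_eps/(_ _ e2)[n0 h0].
  exists n0 => n /h0; rewrite !subr0 ger0_norm ?(sd_ge0 qd)//.
  rewrite -(snorm_sqr qd) ltr_pXn2r// ?nnegrE ?snorm_ge0// ?divr_ge0 ?ltW//.
  rewrite ltr_pdivlMr// => lt; apply: le_lt_trans (sd_cauchy qd _ _) _.
  apply: le_lt_trans lt; apply: ler_wpM2l; rewrite ?snorm_ge0//; lra.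
have [h1 h2] := approxP f h.
have e1 : complex.Re (val f h) = 0 by exact: cvg_unique h1 (key h).
have e2 : complex.Im (val f h) = 0 by exact: cvg_unique h2 (key ('i *: h)).
by case: (val f h) e1 e2 => a b /= -> ->.
Qed.

Lemma in_completion x : completion_pred q (cdot q x).
Proof.
by apply/asboolP; exists (fun=> x); [exact: scauchy_cst|exact: represents_cdot].
Qed.

Definition to_completion (x : F) : completion qd := Sub (cdot q x) (in_completion x).

Lemma val_to_completion x : val (to_completion x) = cdot q x.
Proof. exact: SubK. Qed.

Lemma to_completion_linear : linear to_completion.
Proof.
move=> a x y; apply/val_inj; rewrite val_lin !val_to_completion; apply/funext => h.
by rewrite !fctE; exact: ((cdot_bilinear qd).1 h a x y).
Qed.

HB.instance Definition _ := GRing.isLinear.Build R[i] F (completion qd) _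
  to_completion to_completion_linear.

Lemma to_completion_dot x y :
  completion_dot (to_completion x) (to_completion y) = q x y.
Proof.
refine (@cvg_seq_unique _ (fun=> q x y) _ _ _ _); last exact: cvg_cst.
apply: (@represents_dot (fun=> x) (fun=> y)); rewrite ?val_to_completion.
all: exact: scauchy_cst || exact: represents_cdot.
Qed.

Lemma represents_near u f : scauchy q u -> represents q u (val f) ->
  forall e, 0 < e -> exists n0, forall n, (n0 <= n)%N ->
  snorm completion_dot (f - to_completion (u n)) < e.
Proof.
move=> cu uf e e0; have e2 : 0 < e / 2 by rewrite divr_gt0.
have [n0 h0] := cu _ e2; exists n0 => n n0n.
apply: (@le_lt_trans _ _ (e / 2)); last lra.
rewrite -(@ler_pXn2r _ 2)// ?nnegrE ?snorm_ge0 ?(ltW e2)//.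
rewrite (snorm_sqr completion_semidot).
have cd : scauchy q (fun m => u m - u n) by apply: scauchyB => //; exact: scauchy_cst.
have rd : represents q (fun m => u m - u n) (val (f - to_completion (u n))).
  have -> : f - to_completion (u n) = (-1) *: to_completion (u n) + f.
    by rewrite scaleN1r addrC.
  rewrite val_lin val_to_completion.
  have -> : (fun m => u m - u n) = (fun m => (-1) *: u n + u m).
    by apply/funext => m; rewrite scaleN1r addrC.
  by apply: represents_lin => //; exact: represents_cdot.
refine (cvgr_to_le (@represents_dot _ _ _ _ cd rd cd rd) _).
exists n0 => // m /= n0m; rewrite -(snorm_sqr qd).
rewrite ler_pXn2r// ?nnegrE ?snorm_ge0 ?(ltW e2)//.
exact: ltW (h0 _ _ n0m n0n).
Qed.

(** Replacing each term of a Cauchy sequence of the completion by a nearby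
    element of [F] gives a Cauchy sequence in [F], and its weak limit is the
    limit. *)
Lemma completion_complete u : scauchy completion_dot u ->
  exists z, scvg completion_dot u z.
Proof.
move=> cu; have cd := completion_semidot.
have small := @harmonic_small R.
have /choice[v hv] n : exists x,
    snorm completion_dot (u n - to_completion x) < n.+1%:R^-1.
  have p : 0 < n.+1%:R^-1 :> R by rewrite invr_gt0 ltr0n.
  have [n0 h0] := represents_near (approx_cauchy (u n)) (approxP (u n)) p.
  by exists (approx (u n) n0); apply: h0.
have iso x y : snorm q (x - y) =
    snorm completion_dot (to_completion x - to_completion y).
  by rewrite -linearB /snorm to_completion_dot.
have cv : scauchy q v.
  move=> e e0; have e3 : 0 < e / 3 by rewrite divr_gt0.
  have [n1 h1] := small _ e3; have [n2 h2] := cu _ e3.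
  exists (maxn n1 n2) => m n; rewrite !geq_max => /andP[m1 m2] /andP[l1 l2].
  rewrite iso; have am := lt_trans (hv m) (h1 m m1).
  have an := lt_trans (hv n) (h1 n l1); have amn := h2 _ _ m2 l2.
  have := snorm_tri cd (u m) (to_completion (v m)) (to_completion (v n)).
  have := snorm_tri cd (u n) (u m) (to_completion (v n)).
  rewrite (snormBC cd (to_completion (v m)) (u m)).
  move: am an amn; pose N := snorm completion_dot; rewrite -/N.
  move: (N (u m - to_completion (v m))) (N (u n - to_completion (v n))) => A B.
  move: (N (u m - to_completion (v n))) (N (u m - u n)) => D G.
  move: (N (to_completion (v m) - to_completion (v n))) => H; lra.
pose f h : R[i] := lim (q (v n) h @[n --> \oo]) +i* lim (q (v n) ('i *: h) @[n --> \oo]).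
have vf : represents q v f.
  by move=> h; split; apply: scauchy_dot => //; exact: scauchy_cst.
have Df : completion_pred q f by apply/asboolP; exists v.
pose z : completion qd := Sub f Df.
have vz : represents q v (val z) by rewrite SubK.
exists z; apply: scvg_epsP => e e0; have e2 : 0 < e / 2 by rewrite divr_gt0.
have [n1 h1] := small _ e2; have [n2 h2] := represents_near cv vz e2.
exists (maxn n1 n2) => n; rewrite !geq_max => /andP[l1 l2].
have a1 := lt_trans (hv n) (h1 n l1); have a2 := h2 _ l2.
have := snorm_tri cd (to_completion (v n)) (u n) z.
rewrite (snormBC cd (to_completion (v n)) z).
move: a1 a2; pose N := snorm completion_dot; rewrite -/N.
move: (N (u n - to_completion (v n))) (N (z - to_completion (v n))) => A B.
move: (N (u n - z)) => D; lra.
Qed.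

HB.instance Definition _ := Lmodule_isHilbert.Build R (completion qd)
  completion_semidot completion_dot_eq0 completion_complete.

Lemma rdot_completion f g : rdot f g = completion_dot f g.
Proof. by []. Qed.

Lemma to_completionE x y : rdot (to_completion x) (to_completion y) = q x y.
Proof. by rewrite rdot_completion to_completion_dot. Qed.

Lemma to_completion_dense : hdense (range to_completion).
Proof.
move=> f e e0.
have [n h] := represents_near (approx_cauchy f) (approxP f) e0.
by exists (to_completion (approx f n)); [exists (approx f n)|exact: h].
Qed.

End CompletionHilbert.

Lemma completion_exists (R : realType) (F : lmodType R[i]) (q : F -> F -> R) :
  semidot q -> exists (E : hilbertType R[i]) (T : {linear F -> E}),
  (forall x y, rdot (T x) (T y) = q x y) /\ hdense (range T).
Proof.
move=> qd; exists (completion qd), (to_completion qd); split.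
  exact: to_completionE.
exact: to_completion_dense.
Qed.

(** * Krein spaces carried over by injective linear maps *)

Section KreinBasics.
Variables (R : realType) (E : kreinType R[i]).

Lemma fsym_sym (x y : E) : rdot (fsym x) y = rdot x (fsym y).
Proof. by rewrite adjointP fsym_adjoint. Qed.

Lemma fsym_isometry (x y : E) : rdot (fsym x) (fsym y) = rdot x y.
Proof. by rewrite fsym_sym fsymK. Qed.

Lemma fsym_norm (x : E) : hn (fsym x) = hn x.
Proof. by rewrite /snorm fsym_isometry. Qed.

End KreinBasics.

(** A reproducing kernel space is a space of functions: it arises as the range
    of an injective linear map [j] from an abstract Krein space to functions,
    with the structure that makes [j] unitary. *)
Section KreinRange.
Variables (R : realType) (E : kreinType R[i]) (W : lmodType R[i]).
Variable j : {linear E -> W}.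

Definition krange_pred : pred W := fun w => `[< exists k, j k = w >].

Lemma krange_closed : subsemimod_closed krange_pred.
Proof.
split; [split|].
- by apply/asboolP; exists 0; rewrite linear0.
- move=> _ _ /asboolP[k <-] /asboolP[l <-]; apply/asboolP.
  by exists (k + l); rewrite linearD.
- by move=> a _ /asboolP[k <-]; apply/asboolP; exists (a *: k); rewrite linearZ.
Qed.

HB.instance Definition _ := GRing.isSubmodClosed.Build R[i] W krange_pred
  krange_closed.

Definition krange (j_inj : injective j) := {w : W | krange_pred w}.

Hypothesis j_inj : injective j.
Local Notation T := (krange j_inj).

HB.instance Definition _ := SubChoice.on T.
HB.instance Definition _ := [SubChoice_isSubLmodule of T by <:].

Let val_lin (a : R[i]) (f g : T) : val (a *: f + g) = a *: val f + val g.
Proof. exact: linearP. Qed.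

Definition kcoord (w : T) : E := projT1 (cid (asboolW (valP w))).

Lemma kcoordK w : j (kcoord w) = val w.
Proof. by rewrite /kcoord; case: cid. Qed.

Lemma kcoord_lin : linear kcoord.
Proof.
by move=> a f g; apply: j_inj; rewrite linearP !kcoordK val_lin.
Qed.

HB.instance Definition _ := GRing.isLinear.Build R[i] T E _ kcoord kcoord_lin.

Lemma in_krange k : krange_pred (j k).
Proof. by apply/asboolP; exists k. Qed.

Definition to_krange (k : E) : T := Sub (j k) (in_krange k).

Lemma val_to_krange k : val (to_krange k) = j k.
Proof. exact: SubK. Qed.

Lemma to_krangeK k : kcoord (to_krange k) = k.
Proof. by apply: j_inj; rewrite kcoordK val_to_krange. Qed.

Lemma kcoord_inj : injective kcoord.
Proof. by move=> f g fg; apply/val_inj; rewrite -!kcoordK fg. Qed.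

Lemma to_krange_lin : linear to_krange.
Proof. by move=> a k l; apply: kcoord_inj; rewrite kcoord_lin !to_krangeK. Qed.

HB.instance Definition _ := GRing.isLinear.Build R[i] E T _ to_krange to_krange_lin.

Definition krange_dot (f g : T) : R := rdot (kcoord f) (kcoord g).

Lemma krange_semidot : semidot krange_dot.
Proof.
have rd := @rdot_semidot R E.
split=> [f g|f g h|a f g|f g|f]; rewrite /krange_dot ?linearD ?linearZ /=.
- exact: (sdC rd).
- exact: (sdDl rd).
- exact: (sdZl rd).
- exact: (sdii rd).
- exact: (sd_ge0 rd).
Qed.

Lemma krange_dot_eq0 f : krange_dot f f = 0 -> f = 0.
Proof. by move=> /rdot_eq0 f0; apply: kcoord_inj; rewrite f0 linear0. Qed.

Lemma krange_norm f g : snorm krange_dot (f - g) = hn (kcoord f - kcoord g).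
Proof. by rewrite /snorm /krange_dot linearB. Qed.

Lemma krange_complete u : scauchy krange_dot u -> exists z, scvg krange_dot u z.
Proof.
move=> cu; have [|z /scvg_eps hz] := @hilbert_complete _ E (fun n => kcoord (u n)).
  move=> e e0; have [n0 h0] := cu e e0; exists n0 => m n m0 n1.
  by rewrite -krange_norm; exact: h0.
exists (to_krange z); apply: scvg_epsP => e e0; have [n0 h0] := hz e e0.
by exists n0 => n n0n; rewrite krange_norm to_krangeK; exact: h0.
Qed.

HB.instance Definition _ := Lmodule_isHilbert.Build R T
  krange_semidot krange_dot_eq0 krange_complete.

Lemma rdot_krange (f g : T) : rdot f g = rdot (kcoord f) (kcoord g).
Proof. by []. Qed.

Lemma hn_krange (f : T) : hn f = hn (kcoord f).
Proof. by []. Qed.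

Lemma krange_op (A : boundedOp E E) :
  exists B : boundedOp T T, forall f, B f = to_krange (A (kcoord f)).
Proof.
have [M M0 AM] := boundedOp_bound A.
apply: (@mk_boundedOp _ T T (fun f => to_krange (A (kcoord f))) M).
  by move=> a f g; rewrite !linearP.
by move=> f; rewrite !hn_krange to_krangeK; exact: AM.
Qed.

Definition krange_fsym : boundedOp T T := projT1 (cid (krange_op fsym)).

Lemma krange_fsymE f : krange_fsym f = to_krange (fsym (kcoord f)).
Proof. by rewrite /krange_fsym; case: cid. Qed.

Lemma krange_fsym_adjoint : adjoint krange_fsym =1 krange_fsym.
Proof.
move=> f; apply: adjointE => g; rewrite !krange_fsymE !rdot_krange !to_krangeK.
exact: fsym_sym.
Qed.

Lemma krange_fsymK : involutive krange_fsym.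
Proof.
by move=> f; apply: kcoord_inj; rewrite !krange_fsymE !to_krangeK fsymK.
Qed.

HB.instance Definition _ := Hilbert_isKrein.Build R[i] T
  krange_fsym_adjoint krange_fsymK.

Lemma kdot_krange (f g : T) : kdot f g = kdot (kcoord f) (kcoord g).
Proof.
rewrite /kdot !rdotE /cdot !rdot_krange -[fsym f]/(krange_fsym f) krange_fsymE.
by rewrite to_krangeK linearZ.
Qed.

End KreinRange.

(** * The absolute value of a selfadjoint contraction *)

Lemma scvg_dot2 (R : realType) (V : lmodType R[i]) (q : V -> V -> R) u v z w :
  semidot q -> scvg q u z -> scvg q v w ->
  q (u n) (v n) @[n --> \oo] --> q z w.
Proof.
move=> qd uz vw; have cu := scvg_cauchy qd uz; have cv := scvg_cauchy qd vw.
suff -> : (fun n => q (u n) (v n)) = (fun n => q (u n - z) (v n) + q (v n) z).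
  rewrite -[q z w]add0r (sdC qd z); apply: cvgD; last exact: scvg_dot.
  apply: scauchy_dot0 => //; first by apply: scauchyB => //; exact: scauchy_cst.
  move=> h; have H : q (u n) h - q z h @[n --> \oo] --> q z h - q z h.
    by apply: cvgB; [exact: scvg_dot|exact: cvg_cst].
  rewrite subrr in H.
  suff -> : (fun n => q (u n - z) h) = (fun n => q (u n) h - q z h) by exact: H.
  by apply/funext => n; rewrite (sdBl qd).
by apply/funext => n; rewrite (sdBl qd) (sdC qd (v n)) subrK.
Qed.

Section AbsoluteValue.
Variables (R : realType) (E : hilbertType R[i]) (G : boundedOp E E).
Hypothesis G_sym : forall x y, rdot (G x) y = rdot x (G y).
Hypothesis G_contr : forall x, hn (G x) <= hn x.
Let rd := @rdot_semidot R E.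

(** Converges to [1 - |G|], see [abs_exists]. *)
Fixpoint abs_iter n (x : E) : E :=
  if n is m.+1
  then (2^-1)%:C *: (x - G (G x) + abs_iter m (abs_iter m x)) else 0.

Fixpoint abs_bound n : R := if n is m.+1 then 2^-1 * (1 + abs_bound m ^+ 2) else 0.

Local Notation Y := abs_iter.
Local Notation y := abs_bound.

Lemma abs_bound_ge0 n : 0 <= y n.
Proof. by elim: n => //= n IH; have := sqr_ge0 (y n); lra. Qed.

Lemma abs_bound_le1 n : y n <= 1.
Proof. by elim: n => //= n IH; have := abs_bound_ge0 n; nra. Qed.

Lemma abs_bound_incr n : y n <= y n.+1.
Proof. rewrite /=; have := sqr_ge0 (1 - y n); rewrite sqrrB; lra. Qed.

Lemma abs_bound_cauchy e : 0 < e -> exists n0, forall m n,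
  (n0 <= m)%N -> (n0 <= n)%N -> `|y m - y n| < e.
Proof.
move=> e0; have /cvg_ex[l hl] : cvgn y.
  apply: nondecreasing_is_cvgn; first exact/nondecreasing_seqP/abs_bound_incr.
  by exists 1 => _ [n _ <-]; exact: abs_bound_le1.
have [n0 h0] := cvg_eps hl (divr_gt0 e0 (ltr0n _ 2)).
exists n0 => m n /h0 hm /h0 hn.
have -> : y m - y n = (y m - l) - (y n - l) by ring.
have := ler_normB (y m - l) (y n - l); lra.
Qed.

Lemma abs_iter_linear n : linear (Y n).
Proof.
elim: n => [|n IH] a u v /=; first by rewrite scaler0 addr0.
rewrite !IH !(linearP G) opprD [X in X + _]addrACA -scalerBr.
rewrite [X in _ *: X = _]addrACA -scalerDr [LHS]scalerDr.
by rewrite !scalerA mulrC.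
Qed.

Lemma compl_contr x : hn (x - G (G x)) <= hn x.
Proof.
have h : rdot (G (G x)) (G (G x)) <= rdot (G x) (G x).
  by rewrite -!(snorm_sqr rd) ler_pXn2r// ?nnegrE ?snorm_ge0.
rewrite -(@ler_pXn2r _ 2)// ?nnegrE ?snorm_ge0// !(snorm_sqr rd).
rewrite (sdBl rd) !(sdBr rd) (sdC rd x (G (G x))) (G_sym (G x) x).
by have := sd_ge0 rd (G x); lra.
Qed.

Lemma abs_iter_le n x : hn (Y n x) <= y n * hn x.
Proof.
elim: n x => [|n IH] x /=; first by rewrite (snorm0 rd) mul0r.
rewrite (snormZr rd) ger0_norm ?invr_ge0// -mulrA ler_wpM2l ?invr_ge0//.
rewrite (le_trans (snormD rd _ _))// mulrDl mul1r lerD ?compl_contr//.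
by rewrite (le_trans (IH _))// expr2 -mulrA ler_wpM2l ?abs_bound_ge0.
Qed.

Lemma abs_iter_diff n x : hn (Y n.+1 x - Y n x) <= (y n.+1 - y n) * hn x.
Proof.
elim: n x => [|n IH] x.
  by rewrite !subr0; exact: (abs_iter_le 1).
have -> : Y n.+2 x - Y n.+1 x = (2^-1)%:C *:
    (Y n.+1 (Y n.+1 x - Y n x) + (Y n.+1 (Y n x) - Y n (Y n x))).
  have YB m u v : Y m (u - v) = Y m u - Y m v.
    exact: (zmod_morphism_linear (@abs_iter_linear m)).
  have e (k : R[i]) (b u v : E) : k *: (b + u) - k *: (b + v) = k *: (u - v).
    by rewrite -scalerBr opprD addrACA subrr add0r.
  by rewrite YB subrKA; exact: e.
have -> : y n.+2 - y n.+1 = 2^-1 * (y n.+1 * (y n.+1 - y n) + (y n.+1 - y n) * y n).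
  have ha : y n.+1 = 2^-1 * (1 + y n ^+ 2) by [].
  have -> : y n.+2 = 2^-1 * (1 + y n.+1 ^+ 2) by [].
  by move: (y n.+1) (y n) ha => a b; lra.
rewrite (snormZr rd) ger0_norm ?invr_ge0// -mulrA ler_wpM2l ?invr_ge0//.
rewrite (le_trans (snormD rd _ _))// mulrDl lerD//.
  by rewrite (le_trans (abs_iter_le _ _))// -mulrA ler_wpM2l ?abs_bound_ge0.
rewrite (le_trans (IH _))// -mulrA ler_wpM2l ?subr_ge0 ?abs_bound_incr//.
exact: abs_iter_le.
Qed.

Lemma abs_iter_dist n k x : hn (Y (n + k) x - Y n x) <= (y (n + k) - y n) * hn x.
Proof.
elim: k => [|k IH]; first by rewrite addn0 !subrr (snorm0 rd) mul0r.
rewrite addnS; have := snorm_tri rd (Y (n + k) x) (Y (n + k).+1 x) (Y n x).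
move=> /le_trans; apply.
have := abs_iter_diff (n + k) x; move: IH.
move: (Y (n + k).+1 x) (y (n + k).+1) => z t.
move: (hn (z - _)) (hn (_ - _)) (hn x) => A B D; nra.
Qed.

Lemma abs_iter_sym n u v : rdot (Y n u) v = rdot u (Y n v).
Proof.
elim: n u v => [|n IH] u v /=; first by rewrite (sd0l rd) (sd0r rd).
rewrite (sdZl rd) (sdZr rd) !(sdDl rd) !(sdDr rd) (sdNl rd) (sdNr rd).
by rewrite !G_sym !IH.
Qed.

Lemma abs_iter_comm n x : Y n (G x) = G (Y n x).
Proof.
elim: n x => [|n IH] x /=; first by rewrite linear0.
by rewrite !IH (linearZ_LR G) (linearD G) (linearB G).
Qed.

Lemma abs_iter_cvg x : exists z, scvg rdot (fun n => Y n x) z.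
Proof.
apply: hilbert_complete => e e0; have d0 : 0 < hn x + 1.
  by have := snorm_ge0 rdot x; lra.
have [n0 h0] := abs_bound_cauchy (divr_gt0 e0 d0); exists n0.
have key m n : (n0 <= m)%N -> (m <= n)%N -> hn (Y n x - Y m x) < e.
  move=> m0 mn; have := abs_iter_dist m (n - m) x; rewrite subnKC// => h.
  apply: le_lt_trans h _; have := h0 n m (leq_trans m0 mn) m0.
  rewrite ltr_pdivlMr// => h1; apply: le_lt_trans h1.
  have := snorm_ge0 rdot x; have := ler_norm (y n - y m).
  have := normr_ge0 (y n - y m).
  by move: `|y n - y m| (y n - y m) (hn x) => A B D; nra.
move=> m n m0 n0'; have [mn|nm] := leqP m n; last exact/key/ltnW.
by rewrite (snormBC rd); exact: key.
Qed.

(** The positive square root [P] of [G^2], that is [|G|], as [1 - Y] where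
    [Y] is the limit of the iteration [Y <- (1 - G^2 + Y^2) / 2]. The increments
    of the operators are dominated in norm by those of the same iteration for
    real numbers, with [1 - G^2] replaced by its norm bound 1. *)
Lemma abs_exists : exists P : boundedOp E E,
  [/\ forall x y, rdot (P x) y = rdot x (P y), forall x, 0 <= rdot (P x) x,
      forall x, P (P x) = G (G x) & forall x, P (G x) = G (P x)].
Proof.
have /choice[L hL] := abs_iter_cvg.
have Lc u v : rdot (Y n u) v @[n --> \oo] --> rdot (L u) v.
  exact: (scvg_dot rd).
have U := @cvg_seq_unique R.
have Lsym u v : rdot (L u) v = rdot u (L v).
  refine (U _ _ _ (@Lc u v) _); rewrite (sdC rd u).
  under eq_fun do rewrite abs_iter_sym (sdC rd u).
  exact: Lc.
have LG x : L (G x) = G (L x).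
  apply: rdot_inj => v; rewrite !(sdC rd v); refine (U _ _ _ (@Lc (G x) v) _).
  under eq_fun do rewrite abs_iter_comm G_sym.
  by rewrite G_sym; exact: Lc.
have Llin : linear L.
  move=> a u v; apply: rdot_inj => w; rewrite !(sdC rd w).
  refine (U _ _ _ (@Lc (a *: u + v) w) _).
  rewrite (sdDl rd) rdot_conjl.
  under eq_fun do rewrite abs_iter_linear (sdDl rd) rdot_conjl.
  by apply: cvgD; exact: Lc.
have Lfix x : L x = (2^-1)%:C *: (x - G (G x) + L (L x)).
  apply: rdot_inj => w; rewrite !(sdC rd w) (sdZl rd) (sdDl rd) Lsym.
  refine (U (fun n => rdot (Y n.+1 x) w) _ _ _ _).
    by have := @Lc x w; rewrite -(cvg_shiftS (fun n => rdot (Y n x) w)) Lsym.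
  under eq_fun do rewrite /= (sdZl rd) (sdDl rd) abs_iter_sym.
  apply: cvgMl_tmp; apply: cvgD; first exact: cvg_cst.
  by rewrite Lsym; exact: scvg_dot2.
have Lle x : hn (L x) <= hn x.
  have h : hn (L x) ^+ 2 <= hn x * hn (L x).
    rewrite (snorm_sqr rd); refine (cvgr_to_le (@Lc x (L x)) _).
    apply: nearW => n; apply: le_trans (sd_le rd _ _) _.
    rewrite ler_wpM2r ?snorm_ge0// (le_trans (abs_iter_le n x))//.
    by rewrite ler_piMl ?snorm_ge0 ?abs_bound_le1.
  have := snorm_ge0 rdot (L x); have := snorm_ge0 rdot x.
  move: h; move: (hn x) (hn (L x)) => a b; nra.
have [|x|P hP] := @mk_boundedOp _ _ _ (fun x => x - L x) 2.
- by move=> a u v; rewrite Llin scalerBr opprD addrACA.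
- by rewrite (le_trans (snormB rd _ _))//; have := Lle x; lra.
exists P; split=> [u v|x|x|x]; rewrite !hP.
- by rewrite (sdBl rd) (sdBr rd) Lsym.
- rewrite (sdBl rd) subr_ge0 (le_trans (sd_le rd _ _))//.
  by rewrite -(snorm_sqr rd) expr2 ler_wpM2r ?snorm_ge0.
- have LB u v : L (u - v) = L u - L v.
    exact: (zmod_morphism_linear Llin).
  have h2 : L x + L x = x - G (G x) + L (L x).
    rewrite {1 2}(Lfix x) -scalerDl -rmorphD.
    by rewrite (_ : 2^-1 + 2^-1 = 1) ?scale1r//; lra.
  have -> : x - L x - L (x - L x) = x - (L x + L x) + L (L x).
    by rewrite LB opprB [LHS]addrA [LHS]addrAC opprD [in RHS]addrA.
  by rewrite h2 opprD opprB addrA subrK addrC subrK.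
- by rewrite LG linearB.
Qed.

End AbsoluteValue.

(** * The Krein space induced by a selfadjoint operator *)

(** Polar decomposition. As [|G x| = |P x|], the map [P x -> G x] extends to a
    bounded operator; its adjoint [S] is the sign of [G]. *)
Lemma sign_exists (R : realType) (E : hilbertType R[i]) (G P : boundedOp E E) :
  (forall x y, rdot (G x) y = rdot x (G y)) ->
  (forall x y, rdot (P x) y = rdot x (P y)) ->
  (forall x, P (P x) = G (G x)) -> (forall x, P (G x) = G (P x)) ->
  exists S : boundedOp E E, forall x, P (S x) = G x /\ G (S x) = P x.
Proof.
move=> Gs Ps PG PGC; have rd := @rdot_semidot R E.
have nGP x : hn (G x) = hn (P x) by rewrite /snorm Gs Ps PG.
have [|S' hS' _] := @op_ext R E E E P G 1 ler01.
  by move=> x; rewrite mul1r nGP.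
have [S hS] := adj_exists S'.
have PS x : P (S x) = G x.
  by apply: rdot_inj => y; rewrite -Ps -hS hS' Gs.
exists S => x; split=> //.
apply/eqP; rewrite -subr_eq0; apply/eqP/rdot_eq0.
(* [v] is killed by [P] and [G], and orthogonal to their kernel. *)
set v := G (S x) - P x.
have Pv : P v = 0 by rewrite /v linearB /= PGC PS PG subrr.
have Gv : G v = 0.
  by apply/rdot_eq0/(snorm_eq0 rd); rewrite nGP Pv (snorm0 rd).
by rewrite {1}/v (sdBl rd) Gs Ps Gv Pv !(sd0r rd) subrr.
Qed.

(** Reid's inequality: an operator bounded for one norm and symmetric for a
    weaker seminorm is bounded for that seminorm, with the same bound. For [n] a
    power of 2, Cauchy-Schwarz makes the [p]-square of [D^n x] grow at least
    geometrically with the ratio of the [p]-squares of [D x] and [x], and the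
    norm bound makes it grow at most with the ratio [d ^+ 2]. *)
Lemma reid (R : realType) (E : hilbertType R[i]) (p : E -> E -> R) (D : E -> E)
    (c d : R) :
  semidot p -> (forall x, p x x <= c * hn x ^+ 2) ->
  (forall x y, p (D x) y = p x (D y)) -> 0 <= d ->
  (forall x, hn (D x) <= d * hn x) ->
  forall x, p (D x) (D x) <= d ^+ 2 * p x x.
Proof.
move=> pd pc Dp d0 Dd x; rewrite leNgt; apply/negP => lt.
pose a n := p (iter n D x) (iter n D x).
have a_ge0 n : 0 <= a n by exact: (sd_ge0 pd).
have Dn n y z : p (iter n D y) z = p y (iter n D z).
  by elim: n y z => //= n IH y z; rewrite Dp IH -iterSr.
have a_sq n : a n ^+ 2 <= a 0 * a (n + n)%N.
  have -> : a n = p x (iter (n + n) D x) by rewrite /a Dn iterD.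
  have := sd_cauchy pd x (iter (n + n) D x).
  rewrite -(@ler_pXn2r _ 2)// ?nnegrE ?mulr_ge0 ?snorm_ge0//.
  by rewrite exprMn !(snorm_sqr pd) real_normK ?num_real.
have a_le n : a n <= c * hn x ^+ 2 * (d ^+ 2) ^+ n.
  apply: le_trans (pc _) _.
  have [c0|c0] := leP 0 c; last first.
    have := a_ge0 n; have := pc (iter n D x); rewrite -/(a n).
    have [x0|x0] := eqVneq (hn x) 0.
      have h m : hn (iter m D x) = 0.
        elim: m => //= m IH; apply/eqP; rewrite eq_le snorm_ge0 andbT.
        by rewrite (le_trans (Dd _))// IH mulr0.
      by rewrite h x0 expr0n !mulr0 mul0r.
    have : 0 < hn x ^+ 2 by rewrite exprn_gt0// lt_def x0 snorm_ge0.
    by move=> h1 _ _; have := a_ge0 0%N; have := pc x; rewrite -/(a 0%N); nra.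
  rewrite -mulrA ler_wpM2l// -exprM mulnC exprM -exprMn.
  rewrite ler_pXn2r// ?nnegrE ?mulr_ge0 ?snorm_ge0 ?exprn_ge0//.
  elim: n => [|n IH] /=; first by rewrite expr0 mulr1.
  by rewrite (le_trans (Dd _))// exprS mulrCA ler_wpM2l.
have lt1 : d ^+ 2 * a 0%N < a 1%N by exact: lt.
have d2 : 0 <= d ^+ 2 by exact: exprn_ge0.
have a0 : 0 < a 0%N.
  rewrite lt_def a_ge0 andbT; apply/eqP => a0.
  have := a_sq 1%N; rewrite a0 mul0r => h; have := a_ge0 1%N.
  rewrite a0 mulr0 in lt1; nra.
pose r := a 1%N / a 0%N.
have rd2 : d ^+ 2 < r by rewrite /r ltr_pdivlMr.
have r0 : 0 < r by exact: le_lt_trans rd2.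
have a_pow k : a 0%N * r ^+ (2 ^ k) <= a (2 ^ k)%N.
  elim: k => [|k IH]; first by rewrite expn0 expr1 /r mulrC divfK ?gt_eqF.
  have := a_sq (2 ^ k)%N; rewrite addnn -mul2n -expnS expnS mulnC exprM.
  move: (a (2 ^ k)%N) (a (2 ^ k * 2)%N) (a_ge0 (2 ^ k)%N) (r ^+ (2 ^ k)) IH
    (exprn_ge0 (2 ^ k) (ltW r0)) => A B A0 s IH s0 h.
  rewrite -(ler_pM2l a0); apply: le_trans h.
  have : (a 0%N * s) ^+ 2 <= A ^+ 2.
    by rewrite ler_pXn2r// nnegrE mulr_ge0// ltW.
  by rewrite exprMn [a 0%N ^+ 2]expr2 -mulrA; apply: le_trans.
pose t := d ^+ 2 / r; have t0 : 0 <= t by rewrite divr_ge0// ltW.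
have t1 : t < 1 by rewrite /t ltr_pdivrMr// mul1r.
pose C := c * hn x ^+ 2.
have C0 : 0 < C by have := a_le 0%N; rewrite expr0 mulr1; exact: lt_le_trans.
have key k : a 0%N <= C * t ^+ k.
  have h := le_trans (a_pow k) (a_le (2 ^ k)%N).
  apply: (@le_trans _ _ (C * t ^+ (2 ^ k))).
    by rewrite /t expr_div_n mulrA ler_pdivlMr// exprn_gt0.
  rewrite ler_wpM2l ?(ltW C0)//; apply: ler_wiXn2l => //; first exact: ltW.
  exact/ltnW/ltn_expl.
have tc : C * t ^+ k @[k --> \oo] --> C * 0.
  by apply: cvgMl_tmp; apply: cvg_expr; rewrite ger0_norm.
rewrite mulr0 in tc.
have : a 0%N <= 0 by refine (cvgr_to_ge tc _); apply: nearW; exact: key.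
by rewrite leNgt a0.
Qed.

(** Stated for maps with adjoints, so that it applies to composites of bounded
    operators. *)
Lemma dense_eq (R : realType) (V W : hilbertType R[i]) (f g : V -> W)
    (f' g' : W -> V) (A : set V) :
  (forall x y, rdot (f x) y = rdot x (f' y)) ->
  (forall x y, rdot (g x) y = rdot x (g' y)) ->
  hdense A -> (forall a, A a -> f a = g a) -> f =1 g.
Proof.
move=> ff gg dA fg x; have rd := @rdot_semidot R V.
apply: rdot_inj => y; rewrite !(sdC rdot_semidot y) ff gg; congr (rdot _ _).
apply/eqP; rewrite -subr_eq0; apply/eqP/(hdense_orth dA) => a Aa.
by rewrite (sdC rd) (sdBr rd) -ff -gg fg// subrr.
Qed.

Lemma op_dense_eq (R : realType) (V W : hilbertType R[i]) (f g : boundedOp V W)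
    (A : set V) : hdense A -> (forall a, A a -> f a = g a) -> f =1 g.
Proof. exact: (dense_eq (adjointP f) (adjointP g)). Qed.

Lemma op_dense_sym (R : realType) (V : hilbertType R[i]) (J : boundedOp V V)
    (A : set V) : hdense A ->
  (forall a b, A a -> A b -> rdot (J a) b = rdot a (J b)) ->
  forall x y, rdot (J x) y = rdot x (J y).
Proof.
move=> dA JA; have rd := @rdot_semidot R V; have [J' hJ'] := adj_exists J.
suff e : J' =1 J by move=> x y; rewrite hJ' e.
apply: (op_dense_eq dA) => a Aa; apply/eqP; rewrite -subr_eq0; apply/eqP.
apply: (hdense_orth dA) => b Ab.
by rewrite (sdC rd) (sdBr rd) -hJ' JA// subrr.
Qed.

Section InducedKrein.
Variables (R : realType) (E : hilbertType R[i]) (G : boundedOp E E).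
Hypothesis G_sym : forall x y, rdot (G x) y = rdot x (G y).
Hypothesis G_contr : forall x, hn (G x) <= hn x.
Let rd := @rdot_semidot R E.

(** The Krein space induced by a selfadjoint operator [G]: the completion of
    [E] for [<|G| x, y>], with the sign of [G] as fundamental symmetry.
    An operator [A] with a [G]-adjoint is carried over, because
    [<|G| A x, A y> = <|G| x, S B S A y>] makes Reid's inequality
    applicable. *)
Lemma krein_induced : exists (KK : kreinType R[i]) (T : boundedOp E KK),
  [/\ hdense (range T),
      forall x y, rdot (fsym (T x)) (T y) = rdot (G x) y &
      forall A B : boundedOp E E,
        (forall x y, rdot (G (A x)) y = rdot (G x) (B y)) ->
        exists U : boundedOp KK KK, forall x, U (T x) = T (A x)].
Proof.
have [P [P_sym P_ge0 PP PG]] := abs_exists G_sym G_contr.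
have [S PGS] := sign_exists G_sym P_sym PP PG.
have PS x := (PGS x).1; have GS x := (PGS x).2.
pose p x y := rdot (P x) y.
have pd : semidot p.
  split=> [x y|x y z|a x y|x y|x]; rewrite /p.
  - by rewrite P_sym (sdC rd).
  - by rewrite linearD (sdDl rd).
  - by rewrite linearZ (sdZl rd).
  - by rewrite linearZ (sdii rd).
  - exact: P_ge0.
have [M M0 PM] := boundedOp_bound P.
have pM x : p x x <= M * hn x ^+ 2.
  rewrite /p (le_trans (sd_le rd _ _))// expr2 mulrA.
  by rewrite ler_wpM2r ?snorm_ge0.
have [K0 [T0 [T0p T0d]]] := completion_exists pd.
have T0n x : hn (T0 x) ^+ 2 = p x x by rewrite (snorm_sqr rdot_semidot) T0p.
have [T hT] : exists T : boundedOp E K0, T =1 T0.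
  apply: (@mk_boundedOp _ _ _ T0 (Num.sqrt M)); first exact: linearP.
  move=> x; rewrite -(@ler_pXn2r _ 2)// ?nnegrE ?mulr_ge0 ?sqrtr_ge0 ?snorm_ge0//.
  by rewrite T0n exprMn sqr_sqrtr.
have TSn x : hn (T0 (S x)) <= 1 * hn (T0 x).
  rewrite mul1r -(@ler_pXn2r _ 2)// ?nnegrE ?snorm_ge0// !T0n.
  by rewrite /p PS G_sym GS P_sym.
have [J hJ _] := @op_ext R E _ _ T0 (T0 \o S) 1 ler01 TSn.
have J_sym f g : rdot (J f) g = rdot f (J g).
  apply: (op_dense_sym T0d) => _ _ [x _ <-] [y _ <-].
  by rewrite !hJ /= !T0p /p PS [RHS]P_sym PS G_sym.
have J_invol : involutive J.
  move=> f; apply: (@dense_eq _ _ _ (J \o J) id (J \o J) id _ _ _ T0d) => //.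
    by move=> x y; rewrite /= !J_sym.
  move=> _ [x _ <-]; rewrite /= !hJ /=; apply/eqP; rewrite -subr_eq0; apply/eqP.
  rewrite -linearB; apply/rdot_eq0.
  by rewrite T0p /p linearB /= PS GS subrr (sd0l rd).
have J_adj : adjoint J =1 J by move=> y; apply: adjointE => x; exact: J_sym.
have T_ext (A B : boundedOp E E) :
    (forall x y, rdot (G (A x)) y = rdot (G x) (B y)) ->
    exists U : boundedOp K0 K0, forall x, U (T x) = T (A x).
  move=> AB.
  have [M1 M10 AM] := boundedOp_bound A; have [M2 M20 BM] := boundedOp_bound B.
  have [M3 M30 SM] := boundedOp_bound S.
  pose D x := S (B (S (A x))).
  have pA x y : p (A x) (A y) = p x (D y).
    by rewrite /p /D P_sym -GS -G_sym AB G_sym -PS P_sym.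
  have Dp x y : p (D x) y = p x (D y) by rewrite (sdC pd) -!pA (sdC pd).
  pose d := M3 * (M2 * (M3 * M1)).
  have d0 : 0 <= d by rewrite !mulr_ge0.
  have Dd x : hn (D x) <= d * hn x.
    rewrite (le_trans (SM _))// -mulrA ler_wpM2l// (le_trans (BM _))//.
    rewrite -mulrA ler_wpM2l// (le_trans (SM _))// -mulrA ler_wpM2l//.
  have TA x : hn (T0 (A x)) <= Num.sqrt d * hn (T0 x).
    rewrite -(@ler_pXn2r _ 2)// ?nnegrE ?mulr_ge0 ?sqrtr_ge0 ?snorm_ge0//.
    rewrite exprMn (sqr_sqrtr d0) !T0n pA (le_trans (sd_le pd _ _))//.
    rewrite -(@ler_pXn2r _ 2)// ?nnegrE ?mulr_ge0 ?snorm_ge0 ?(sd_ge0 pd)//.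
    rewrite exprMn !(snorm_sqr pd) exprMn expr2 mulrCA ler_wpM2l ?(sd_ge0 pd)//.
    exact: (reid pd pM).
  have [U hU _] := @op_ext R E _ _ T0 (T0 \o A) (Num.sqrt d) (sqrtr_ge0 d) TA.
  by exists U => x; rewrite !hT hU.
have Td : hdense (range T).
  move=> f e e0; have [_ [x _ <-] h] := T0d f e e0.
  by exists (T x); [exists x|rewrite hT].
have JT x y : rdot (J (T x)) (T y) = rdot (G x) y by rewrite !hT hJ T0p /p PS.
(* Adding the fundamental symmetry to [K0] needs its class as a constructor. *)
case: K0 T Td J J_adj J_invol JT T_ext {T0 T0p T0d T0n hT TSn hJ J_sym} =>
  [Ks Kc] T Td J J_adj J_invol JT T_ext.
pose mx := Hilbert_isKrein.Build R[i] (Hilbert.Pack Kc) J_adj J_invol.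
pose KK : kreinType R[i] := HB.pack Ks Kc mx.
by exists KK, T.
Qed.


End InducedKrein.

(** * The Hellinger-Toeplitz theorem *)

(** If [f] is unbounded, choose [x n] with [f (x n)] longer than [4 ^+ n] times
    [x n], and sum steps of length [3 ^- n] in the directions [f (x n)], with
    signs chosen against cancellation. The steps after the [n]-th have total
    length half of it, so the sum [z] pairs with [f (x n)] to at least half of
    [3 ^- n * hn (f (x n))], which contradicts the bound [hn (x n) * hn (g z)]
    once [(4 / 3) ^+ n] exceeds [2 * hn (g z)]. *)
Lemma hellinger_toeplitz (R : realType) (V W : hilbertType R[i])
    (f : V -> W) (g : W -> V) : linear f ->
  (forall x y, rdot (f x) y = rdot x (g y)) ->
  exists A : boundedOp V W, A =1 f.
Proof.
move=> fl fg; have rd := @rdot_semidot R W; have rdV := @rdot_semidot R V.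
apply: contrapT => nf.
have /choice[x hx] n : exists x, 4 ^+ n * hn x < hn (f x).
  apply: contrapT => h; apply: nf; apply: (@mk_boundedOp _ _ _ _ (4 ^+ n)) => // x.
  by rewrite leNgt; apply/negP => lt; apply: h; exists x.
pose w n := f (x n); pose a n : R := 3 ^- n.
have a0 n : 0 < a n by rewrite invr_gt0 exprn_gt0.
have aS n : a n.+1 = a n / 3 by rewrite /a exprS invfM mulrC.
have w0 n : 0 < hn (w n).
  by apply: le_lt_trans (hx n); rewrite mulr_ge0 ?snorm_ge0 ?exprn_ge0.
pose s n y : R := if 0 <= rdot (w n) y then 1 else -1.
have sE n y : s n y * rdot (w n) y = `|rdot (w n) y| /\ `|s n y| = 1.
  rewrite /s; case: (leP 0 (rdot (w n) y)) => h.
    by rewrite mul1r ger0_norm// normr1.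
  by rewrite mulN1r ltr0_norm// normrN normr1.
pose fix y n := if n is m.+1
  then y m + (s m (y m) * a m / hn (w m))%:C *: w m else 0.
have yS n : hn (y n.+1 - y n) = a n.
  rewrite /= addrC addKr (snormZr rd) !normrM (sE n _).2 mul1r (gtr0_norm (a0 n)).
  by rewrite gtr0_norm ?invr_gt0// divfK ?gt_eqF.
have big n : a n * hn (w n) <= `|rdot (w n) (y n.+1)|.
  have [h h1] := sE n (y n).
  have -> : rdot (w n) (y n.+1) =
      s n (y n) * (`|rdot (w n) (y n)| + a n * hn (w n)).
    rewrite /= (sdDr rd) (sdZr rd) -(snorm_sqr rd) mulrDr -h mulrA.
    congr (_ + _); last by field; rewrite gt_eqF.
    by rewrite /s; case: ifP; rewrite ?mulrNN !mul1r.
  rewrite normrM h1 mul1r ger0_norm ?lerDr//.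
  by rewrite addr_ge0// mulr_ge0 ?snorm_ge0// ltW.
have dist n k : hn (y (n + k)%N - y n) <= 3 / 2 * (a n - a (n + k)%N).
  elim: k => [|k IH]; first by rewrite addn0 !subrr (snorm0 rd) mulr0.
  rewrite addnS aS; have := snorm_tri rd (y (n + k)%N) (y (n + k).+1%N) (y n).
  rewrite yS; move: IH; move: (a (n + k)%N) (a n) (hn _) (hn _) => A B C D; lra.
have dist' n k : hn (y (n + k)%N - y n) <= 3 / 2 * a n.
  apply: le_trans (dist n k) _; have := a0 (n + k)%N; lra.
have ac : 3 / 2 * a n @[n --> \oo] --> (3 / 2 * 0 : R).
  apply: cvgMl_tmp; rewrite (_ : a = fun n => 3^-1 ^+ n); last first.
    by apply/funext => n; rewrite /a exprVn.
  apply: cvg_expr; rewrite ger0_norm ?invr_ge0//; lra.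
rewrite mulr0 in ac.
have [z hz] : exists z, scvg rdot y z.
  apply: hilbert_complete => e e0; have [n0 h0] := cvg_eps ac e0.
  have key m n : (n0 <= m)%N -> (m <= n)%N -> hn (y n - y m) < e.
    move=> m0 mn; have := dist' m (n - m)%N; rewrite subnKC// => /le_lt_trans.
    apply; have := h0 m m0; rewrite subr0 ger0_norm// mulr_ge0 ?(ltW (a0 m))//; lra.
  exists n0 => m n m0 n0'; have [mn|nm] := leqP m n; last exact/key/ltnW.
  by rewrite (snormBC rd); exact: key.
have zn n : hn (z - y n) <= 3 / 2 * a n.
  apply/ler_addgt0Pr => e e0; have [n1 h1] := scvg_eps hz e0.
  have := dist' n n1; have := h1 _ (leq_addl n n1).
  have := snorm_tri rd (y (n + n1)%N) z (y n); rewrite (snormBC rd z (y (n + n1)%N)).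
  move: (hn _) (hn _) (hn _) (a n) => A B C D; lra.
have lb n : a n * hn (w n) / 2 <= hn (x n) * hn (g z).
  apply: le_trans (sd_cauchy rdV _ _); rewrite -fg -/(w n).
  have := big n; have := zn n.+1; rewrite aS.
  have := sd_cauchy rd (w n) (z - y n.+1); rewrite (sdBr rd).
  have := ler_normB (rdot (w n) z) (rdot (w n) z - rdot (w n) (y n.+1)).
  rewrite subKr; have := w0 n.
  move: (rdot (w n) z) (rdot (w n) (y n.+1)) (hn _) (hn _) (a n) => r t A B C.
  move: (`|r|) (`|r - t|) (`|t|) => r' rt t'; nra.
have key n : 2^-1 <= hn (g z) * (3 / 4) ^+ n.
  have := lb n; have := hx n; rewrite -/(w n) => h1 h2.
  have p4 : 0 < 4 ^+ n :> R by exact: exprn_gt0.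
  have xn : 0 < hn (x n).
    rewrite lt_def snorm_ge0 andbT; apply/eqP => x0.
    by have := mulr_gt0 (a0 n) (w0 n); move: h2; rewrite x0 mul0r; lra.
  rewrite expr_div_n mulrA ler_pdivlMr// -(ler_pM2l xn).
  rewrite -(ler_pM2l (a0 n)).
  have e : a n * 3 ^+ n = 1 by rewrite /a mulVf// gt_eqF// exprn_gt0.
  have -> : a n * (hn (x n) * (hn (g z) * 3 ^+ n)) = (a n * 3 ^+ n) * (hn (x n) * hn (g z)).
    by ring.
  rewrite e mul1r; apply: le_trans h2.
  move: (a n) (a0 n) (4 ^+ n) h1 => A A0 F h1; nra.
have tc : hn (g z) * (3 / 4) ^+ k @[k --> \oo] --> hn (g z) * 0.
  by apply: cvgMl_tmp; apply: cvg_expr; rewrite ger0_norm; lra.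
rewrite mulr0 in tc.
have : 2^-1 <= 0 :> R by refine (cvgr_to_ge tc _); apply: nearW; exact: key.
lra.
Qed.

(** * Finitely supported functions and kernel forms *)

Section FiniteSupport.
Variables (R : realType) (H : hilbertType R[i]) (X : choiceType).
Implicit Types (x y : X) (f g : X -> H) (s : seq X).

Definition covers s f := forall x, x \notin s -> f x = 0.

Lemma fin_suppP f : fin_supp f <-> exists2 s, uniq s & covers s f.
Proof.
split=> [/finite_seqP[s es]|[s _ sf]].
  exists (undup s) => [|x]; first exact: undup_uniq.
  rewrite mem_undup => xs; apply/eqP; apply: contraNT xs => fx.
  by have : [set x | f x != 0] x by []; rewrite es.
apply: (@sub_finite_set _ _ [set` s]); last by apply/finite_seqP; exists s.
by move=> x /=; apply: contraNT => /sf ->.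
Qed.

Lemma fsum_seq (V : nmodType) (F : X -> V) s : uniq s ->
  (forall x, x \notin s -> F x = 0) ->
  \sum_(x \in [set: X]) F x = \sum_(x <- s) F x.
Proof.
move=> us Fs; rewrite [RHS]fsbig_seq//; symmetry.
apply: (fsbig_widen [set` s] setT F) => // x [_ xs] /=.
by apply: Fs; apply/negP.
Qed.

Definition fs_pred : pred (X -> H) := fun f => `[< fin_supp f >].

Lemma fs_closed : subsemimod_closed fs_pred.
Proof.
have U f g (h : X -> H) : fin_supp f -> fin_supp g ->
    (forall x, f x = 0 -> g x = 0 -> h x = 0) -> fin_supp h.
  move=> /fin_suppP[s us sf] /fin_suppP[t ut tg] fgh; apply/fin_suppP.
  exists (undup (s ++ t)); first exact: undup_uniq.
  by move=> x; rewrite mem_undup mem_cat negb_or => /andP[/sf + /tg]; exact: fgh.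
split; [split|].
- apply/asboolP/fin_suppP; exists [::] => // x _.
- move=> f g /asboolP ff /asboolP gg; apply/asboolP; apply: (U f g) => // x fx gx.
  by rewrite fctE fx gx addr0.
- move=> a f /asboolP ff; apply/asboolP; apply: (U f f) => // x fx _.
  by rewrite fctE fx scaler0.
Qed.

HB.instance Definition _ := GRing.isSubmodClosed.Build R[i] (X -> H) fs_pred fs_closed.

End FiniteSupport.

Definition fs (R : realType) (H : hilbertType R[i]) (X : choiceType) :=
  {f : X -> H | fs_pred f}.

HB.instance Definition _ (R : realType) (H : hilbertType R[i]) (X : choiceType) :=
  SubChoice.on (fs H X).
HB.instance Definition _ (R : realType) (H : hilbertType R[i]) (X : choiceType) :=
  [SubChoice_isSubLmodule of fs H X by <:].

Section FsTheory.
Variables (R : realType) (H : hilbertType R[i]) (X : choiceType).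
Local Notation fs := (fs H X).
Implicit Types (x y : X) (f g : fs) (s : seq X).

Lemma fs_val_lin (a : R[i]) f g : val (a *: f + g) = a *: val f + val g.
Proof. exact: linearP. Qed.

Lemma fs_valZ (a : R[i]) f x : val (a *: f) x = a *: val f x.
Proof. by rewrite -[_ *: f]addr0 fs_val_lin fctE raddf0 addr0. Qed.

Lemma fs_fin_supp f : fin_supp (val f).
Proof. by have := valP f; move=> /asboolP. Qed.

Lemma fs_of (h : X -> H) : fin_supp h -> exists f, val f = h.
Proof. by move=> /asboolP hs; exists (Sub h hs); rewrite SubK. Qed.

Lemma fs_cover f g : exists s, [/\ uniq s, covers s (val f) & covers s (val g)].
Proof.
have /fin_suppP[s us sf] := fs_fin_supp f.
have /fin_suppP[t ut tg] := fs_fin_supp g.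
exists (undup (s ++ t)); split; first exact: undup_uniq.
- by move=> x; rewrite mem_undup mem_cat negb_or => /andP[/sf].
- by move=> x; rewrite mem_undup mem_cat negb_or => /andP[_ /tg].
Qed.

Lemma covers_lin (a : R[i]) f g s : covers s (val f) -> covers s (val g) ->
  covers s (val (a *: f + g)).
Proof.
by move=> sf sg x xs; rewrite fs_val_lin !fctE sf// sg// scaler0 addr0.
Qed.

Lemma single_fs_pred x (xi : H) : fs_pred (single x xi).
Proof.
apply/asboolP/fin_suppP; exists [:: x] => // y.
by rewrite inE /single => /negPf ->.
Qed.

Definition single_fs x (xi : H) : fs := Sub (single x xi) (single_fs_pred x xi).

Lemma val_single x xi : val (single_fs x xi) = single x xi.
Proof. exact: SubK. Qed.

Lemma single_fs_lin x : linear (single_fs x).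
Proof.
move=> a u v; apply/val_inj; rewrite fs_val_lin !val_single; apply/funext => y.
by rewrite /single !fctE; case: eqP => // _; rewrite scaler0 addr0.
Qed.

HB.instance Definition _ x := GRing.isLinear.Build R[i] H fs _ (single_fs x)
  (single_fs_lin x).

Lemma covers_single x xi : covers [:: x] (val (single_fs x xi)).
Proof. by move=> y; rewrite inE val_single /single => /negPf ->. Qed.

Section Extension.
Variables (E : lmodType R[i]) (v : X -> {linear H -> E}).

(** The universal property of [fs H X], the direct sum of copies of [H] indexed
    by [X]. *)
Definition fs_sum f : E := \sum_(x \in [set: X]) v x (val f x).

Lemma fs_sumE s f : uniq s -> covers s (val f) ->
  fs_sum f = \sum_(x <- s) v x (val f x).
Proof. by move=> us sf; apply: fsum_seq => // x /sf ->; rewrite linear0. Qed.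

Lemma fs_sum_linear : linear fs_sum.
Proof.
move=> a f g; have [s [us sf sg]] := fs_cover f g.
rewrite !(fs_sumE us)//; last exact: covers_lin.
rewrite scaler_sumr -big_split; apply: eq_bigr => x _.
by rewrite fs_val_lin !fctE linearP.
Qed.

HB.instance Definition _ := GRing.isLinear.Build R[i] fs E _ fs_sum fs_sum_linear.

Lemma fs_sum_single x xi : fs_sum (single_fs x xi) = v x xi.
Proof.
rewrite (@fs_sumE [:: x])//; last exact: covers_single.
by rewrite big_seq1 val_single /single eqxx.
Qed.

End Extension.

Lemma fs_decomp s f : uniq s -> covers s (val f) ->
  f = \sum_(x <- s) single_fs x (val f x).
Proof.
move=> us sf; apply/val_inj; apply/funext => y.
rewrite raddf_sum fct_sumE /=.
transitivity (\sum_(x <- s) if y == x then val f x else 0); last first.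
  by apply: eq_bigr => x _; rewrite -[LHS]/(single x (val f x) y) -val_single.
have [ys|ys] := boolP (y \in s); last first.
  rewrite sf// big1_seq// => x /= xs; case: eqP => // yx.
  by rewrite yx xs in ys.
rewrite (bigD1_seq y)//= eqxx big1 ?addr0// => x; rewrite eq_sym => /negPf.
by move=> ->.
Qed.

Lemma fs_ind (P : fs -> Prop) : P 0 -> (forall f g, P f -> P g -> P (f + g)) ->
  (forall x xi, P (single_fs x xi)) -> forall f, P f.
Proof.
move=> P0 PD P1 f; have [s [us sf _]] := fs_cover f f.
by rewrite (fs_decomp us sf); elim/big_ind: _.
Qed.

Section Kernel.
Variable K : opkernel H X.

Lemma kernel_formE s (f g : X -> H) : uniq s -> covers s f -> covers s g ->
  kernel_form K f g = \sum_(x <- s) \sum_(y <- s) hdot (K x y (f y)) (g x).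
Proof.
move=> us sf sg; rewrite /kernel_form (fsum_seq us) => [|x /sg ->]; last first.
  by apply: fsbig1 => y _; rewrite raddf0.
apply: eq_bigr => x _; apply: fsum_seq => // y /sf ->.
by rewrite linear0 linear0l.
Qed.

Definition kform f g : R := complex.Re (kernel_form K (val f) (val g)).

Lemma kformE s f g : uniq s -> covers s (val f) -> covers s (val g) ->
  kform f g = \sum_(x <- s) \sum_(y <- s) rdot (K x y (val f y)) (val g x).
Proof.
move=> us sf sg; rewrite /kform (kernel_formE us)// raddf_sum.
by apply: eq_bigr => x _; rewrite raddf_sum.
Qed.

Lemma kform_lin (a : R[i]) f g h :
  kform (a *: f + g) h =
  complex.Re a * kform f h + complex.Im a * kform ('i *: f) h + kform g h.
Proof.
have /fin_suppP[u uu uh] := fs_fin_supp h.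
have [t [ut tf tg]] := fs_cover f g.
pose s := undup (u ++ t).
have us : uniq s by exact: undup_uniq.
have sh : covers s (val h).
  by move=> x; rewrite mem_undup mem_cat negb_or => /andP[/uh].
have sf : covers s (val f).
  by move=> x; rewrite mem_undup mem_cat negb_or => /andP[_ /tf].
have sg : covers s (val g).
  by move=> x; rewrite mem_undup mem_cat negb_or => /andP[_ /tg].
have rd := @rdot_semidot R H.
have si : covers s (val ('i *: f)) by move=> x xs; rewrite fs_valZ sf// scaler0.
rewrite !(kformE us)//; last exact: covers_lin.
rewrite !mulr_sumr -!big_split; apply: eq_bigr => x _.
rewrite !mulr_sumr -!big_split; apply: eq_bigr => y _.
rewrite fs_val_lin fs_valZ !fctE linearP linearZ.
by rewrite (sdDl rd) (sd_complexZ rd a).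
Qed.

Lemma kform0l h : kform 0 h = 0.
Proof.
have [s [us sh _]] := fs_cover h h.
rewrite (kformE us)//.
rewrite big1// => x _; rewrite big1// => y _.
by rewrite (_ : val (0 : fs) y = 0)// linear0 (sd0l rdot_semidot).
Qed.

Lemma kform_single x y xi eta :
  kform (single_fs y eta) (single_fs x xi) = rdot (K x y eta) xi.
Proof.
have [->|xy] := eqVneq x y.
  rewrite (@kformE [:: y])//; try exact: covers_single.
  by rewrite !big_seq1 !val_single /single eqxx.
have c z h : z \in [:: x; y] -> covers [:: x; y] (val (single_fs z h)).
  move=> zs t ts; apply: covers_single; rewrite inE; apply: contraNN ts.
  by move=> /eqP ->.
rewrite (@kformE [:: x; y]); first last.
- by apply: c; rewrite inE eqxx.
- by apply: c; rewrite !inE eqxx orbT.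
- by rewrite /= inE xy.
rewrite !big_cons !big_nil !val_single /single eqxx (negPf xy) eq_sym (negPf xy).
by rewrite eqxx !addr0 !linear0 !(sd0l rdot_semidot) !(sd0r rdot_semidot) !addr0 add0r.
Qed.

Hypothesis K_herm : hermitian_kernel K.

Lemma hermitian_rdot x y u v : rdot (K x y u) v = rdot u (K y x v).
Proof. by rewrite (K_herm y x) -adjointP. Qed.

Lemma kform_sym f g : kform f g = kform g f.
Proof.
have [s [us sf sg]] := fs_cover f g.
rewrite !(kformE us)// exchange_big; apply: eq_bigr => x _; apply: eq_bigr => y _.
by rewrite hermitian_rdot (sdC rdot_semidot).
Qed.

Lemma kform_ii f g : kform ('i *: f) ('i *: g) = kform f g.
Proof.
have [s [us sf sg]] := fs_cover f g.
have c (h : fs) : covers s (val h) -> covers s (val ('i *: h)).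
  by move=> sh x xs; rewrite fs_valZ sh// scaler0.
have cf := c _ sf; have cg := c _ sg.
rewrite !(kformE us)//; apply: eq_bigr => x _; apply: eq_bigr => y _.
by rewrite !fs_valZ linearZ (sdii rdot_semidot).
Qed.

Lemma kformDl f g h : kform (f + g) h = kform f h + kform g h.
Proof. by rewrite -[f in LHS]scale1r kform_lin /= mul1r mul0r addr0. Qed.

Lemma kform_scale (a : R[i]) f h : kform (a *: f) h =
  complex.Re a * kform f h + complex.Im a * kform ('i *: f) h.
Proof. by have := kform_lin a f 0 h; rewrite !addr0 kform0l addr0. Qed.

Lemma kformZl (a : R) f h : kform (a%:C *: f) h = a * kform f h.
Proof. by rewrite kform_scale /= mul0r addr0. Qed.

Lemma kform_il f h : kform ('i *: f) h = - kform f ('i *: h).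
Proof.
rewrite -kform_ii scalerA -expr2 sqr_i kform_scale /= oppr0 mul0r addr0.
by rewrite mulN1r.
Qed.

Lemma kform_conj (a : R[i]) f h : kform f (a^*%C *: h) = kform (a *: f) h.
Proof.
rewrite kform_sym (kform_scale a^*%C) (kform_scale a) (kform_sym h).
rewrite (kform_sym ('i *: h)) kform_il; case: a => a b /=; ring.
Qed.

Lemma kform_semidot : (forall f, 0 <= kform f f) -> semidot kform.
Proof.
move=> K0; split=> //.
- exact: kform_sym.
- exact: kformDl.
- exact: kformZl.
- exact: kform_ii.
Qed.

End Kernel.
End FsTheory.

(** * From a majorant to a Kolmogorov decomposition *)

(** Polarisation: apply Cauchy-Schwarz to the nonnegative forms [p + k] and
    [p - k], then to the two resulting terms. *)
Lemma dominated_cauchy (R : realType) (F : lmodType R[i]) (p k : F -> F -> R) :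
  semidot p -> (forall f g, k f g = k g f) ->
  (forall f g h, k (f + g) h = k f h + k g h) ->
  (forall (a : R) f g, k (a%:C *: f) g = a * k f g) ->
  (forall f g, k ('i *: f) ('i *: g) = k f g) ->
  (forall f, `|k f f| <= p f f) ->
  forall f g, `|k f g| <= snorm p f * snorm p g.
Proof.
move=> pd kC kD kZ ki kp f g.
have sdp (s : R) : `|s| = 1 -> semidot (fun f g => p f g + s * k f g).
  move=> s1; split=> [u v|u v w|a u v|u v|u].
  - by rewrite (sdC pd) kC.
  - by rewrite (sdDl pd) kD; ring.
  - by rewrite (sdZl pd) kZ; ring.
  - by rewrite (sdii pd) ki.
  - have := kp u; have := ler_norm (- (s * k u u)).
    by rewrite normrN normrM s1 mul1r; lra.
have sd1 := sdp 1 (normr1 _); have sd2 := sdp (-1) (normrN1 _).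
have := sd_cauchy sd1 f g; have := sd_cauchy sd2 f g.
set A := snorm _ f; set B := snorm _ g; set C := snorm _ f; set D := snorm _ g.
have eA : A ^+ 2 = p f f - k f f by rewrite (snorm_sqr sd2) mulN1r.
have eB : B ^+ 2 = p g g - k g g by rewrite (snorm_sqr sd2) mulN1r.
have eC : C ^+ 2 = p f f + k f f by rewrite (snorm_sqr sd1) mul1r.
have eD : D ^+ 2 = p g g + k g g by rewrite (snorm_sqr sd1) mul1r.
rewrite mul1r mulN1r => h1 h2.
have h3 : A * B + C * D <= 2 * (snorm p f * snorm p g).
  rewrite -(@ler_pXn2r _ 2)// ?nnegrE ?addr_ge0 ?mulr_ge0 ?snorm_ge0//.
  rewrite !exprMn !(snorm_sqr pd).
  have -> : 2 ^+ 2 * (p f f * p g g) = (A ^+ 2 + C ^+ 2) * (B ^+ 2 + D ^+ 2).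
    by rewrite eA eB eC eD; ring.
  by have := sqr_ge0 (A * D - C * B); nra.
have := ler_normB (p f g + k f g) (p f g - k f g).
rewrite (_ : _ - _ = 2 * k f g); last by ring.
rewrite normrM ger0_norm//; lra.
Qed.

Section Push.
Variables (R : realType) (H : hilbertType R[i]) (S : Type) (X : choiceType).
Variable phi : S -> X -> X.

Definition push_fs (a : S) : fs H X -> fs H X :=
  fs_sum (fun x => single_fs (phi a x) : {linear H -> fs H X}).

HB.instance Definition _ a := GRing.Linear.on (push_fs a).

Lemma push_fs_single a x (xi : H) :
  push_fs a (single_fs x xi) = single_fs (phi a x) xi.
Proof. exact: fs_sum_single. Qed.

Lemma push_fsE a (f : fs H X) : push phi a (val f) = val (push_fs a f).
Proof.
have [s [us sf _]] := fs_cover f f.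
rewrite /push_fs (fs_sumE _ us sf) raddf_sum /push (fsum_seq us) => [|x /sf ->].
  by apply: eq_bigr => x _; rewrite -[LHS]val_single.
by apply/funext => y; rewrite /single; case: eqP.
Qed.

End Push.

Lemma sqrtC_real (R : realType) (r : R) : 0 <= r -> sqrtC r%:C = (Num.sqrt r)%:C.
Proof.
move=> r0; apply/eqP; rewrite -(@eqrXn2 _ 2)// ?sqrtC_ge0 ?lecR ?sqrtr_ge0//.
by rewrite sqrtCK -rmorphXn /= sqr_sqrtr.
Qed.

Lemma lin_span_sum (R : realType) (V : normedModType R[i]) (A : set V)
    (I : Type) (s : seq I) (F : I -> V) :
  (forall i, A (F i)) -> lin_span A (\sum_(i <- s) F i).
Proof.
move=> AF; exists (size s), (fun=> 1), (fun i => F (tnth (in_tuple s) i)).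
split=> //; rewrite big_tnth; apply: eq_bigr => i _.
by rewrite scale1r.
Qed.

Section Majorant.
Variables (R : realType) (H : hilbertType R[i]) (S : starMonoidType).
Variables (X : choiceType) (phi : S -> X -> X) (K : opkernel H X).
Hypothesis phi_action : is_action phi.
Hypothesis K_herm : hermitian_kernel K.
Hypothesis K_inv : forall x y a, K x (phi a y) =1 K (phi (a^-1)%g x) y.

Lemma push_fs1 (f : fs H X) : push_fs phi 1%g f = f.
Proof.
elim/fs_ind: f => [|f g IH IH'|x xi]; first by rewrite linear0.
  by rewrite linearD /= IH IH'.
by rewrite push_fs_single phi_action.1.
Qed.

Lemma push_fsM a b (f : fs H X) :
  push_fs phi (a * b)%g f = push_fs phi a (push_fs phi b f).
Proof.
elim/fs_ind: f => [|f g IH IH'|x xi]; first by rewrite !linear0.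
  by rewrite !linearD /= IH IH'.
by rewrite !push_fs_single phi_action.2.
Qed.

Lemma posdef_kform (L : opkernel H X) : posdef_kernel L ->
  semidot (kform L) /\
  forall f : fs H X, kernel_form L (val f) (val f) = (kform L f f)%:C.
Proof.
move=> [L_herm L0]; have h (f : fs H X) := L0 _ (fs_fin_supp f).
split.
  apply: kform_semidot => // f; have := h f.
  by rewrite lecE => /andP[].
move=> f; have := h f; rewrite lecE /kform => /andP[/eqP].
by case: (kernel_form _ _ _) => u v /= -> _.
Qed.

Lemma le_kernel_kform (A B : opkernel H X) : le_kernel A B ->
  forall f : fs H X, kform A f f <= kform B f f.
Proof.
by move=> AB f; have := AB _ (fs_fin_supp f); rewrite lecE => /andP[].
Qed.

Lemma opp_kform (A : opkernel H X) (f g : fs H X) :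
  kform (opp_kernel A) f g = - kform A f g.
Proof.
have rd := @rdot_semidot R H.
have [s [us sf sg]] := fs_cover f g.
rewrite !(kformE _ us)// -sumrN; apply: eq_bigr => x _.
by rewrite -sumrN; apply: eq_bigr => y _; rewrite -(sdNl rd).
Qed.

Lemma kform_push (a : S) (f g : fs H X) :
  kform K (push_fs phi a f) g = kform K f (push_fs phi (a^-1)%g g).
Proof.
have kC := kform_sym K_herm.
elim/fs_ind: f => [|f f' IH IH'|y eta].
- by rewrite linear0 !kform0l.
- by rewrite linearD !kformDl IH IH'.
rewrite push_fs_single kC [RHS]kC.
elim/fs_ind: g => [|g g' IH IH'|x xi].
- by rewrite linear0 !kform0l.
- by rewrite linearD !kformDl IH IH'.
by rewrite push_fs_single kC [RHS]kC !kform_single K_inv.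
Qed.

(** [K] is the Gram kernel of a selfadjoint contraction [G] on the completion
    [E] of the finitely supported functions for [L]; the Krein space is the one
    induced by [G]. The [phi]-boundedness of [L] makes the shifts [push_fs phi a]
    operators on [E], and the invariance of [K] makes the shifts by [a] and
    [a^-1] [G]-adjoint to each other, so [krein_induced] carries them over. *)
Lemma majorant_kolmogorov (L : opkernel H X) :
  posdef_bounded phi L -> le_kernel (opp_kernel L) K -> le_kernel K L ->
  exists (KK : kreinType R[i]) (V : X -> boundedOp H KK),
    kolmogorov_decomposition K V /\
    exists U : S -> boundedOp KK KK,
      is_representation U /\ forall a x xi, V (phi a x) xi = U a (V x xi).
Proof.
move=> [L_pos L_bnd] LK KL.
have [ld L_real] := posdef_kform L_pos.
have kC := kform_sym K_herm.
have kl (f : fs H X) : `|kform K f f| <= kform L f f.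
  rewrite ler_norml (le_kernel_kform KL) andbT -opp_kform.
  exact: le_kernel_kform.
have kCS := dominated_cauchy ld kC (kformDl K) (kformZl K) (kform_ii K) kl.
have [E [i [iE i_dense]]] := completion_exists ld.
have rd := @rdot_semidot R E.
have i_norm f : hn (i f) = snorm (kform L) f by rewrite /snorm iE.
have /choice[z hz] f : exists z, (forall g, kform K f g = rdot (i g) z) /\
    hn z <= hn (i f).
  have [||||z0 [h1 _ h2]] := @riesz_norm _ _ _ i (kform K f) (hn (i f)).
  - by move=> g h; rewrite kC kformDl !(kC f).
  - by move=> a g; rewrite kC kformZl (kC f).
  - exact: snorm_ge0.
  - by move=> g; rewrite (le_trans (ler_norm _))// (le_trans (kCS f g))// !i_norm.
  by exists z0.
have i_orth (u : E) : (forall f, rdot (i f) u = 0) -> u = 0.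
  move=> h; apply: (hdense_orth i_dense) => _ [f _ <-].
  by rewrite (sdC rd).
have z_lin : linear z.
  move=> a f g; apply/eqP; rewrite -subr_eq0; apply/eqP/i_orth => h.
  rewrite (sdBr rd) (sdDr rd) rdot_conj -linearZ -!(hz _).1.
  by rewrite kformDl -kform_conj // subrr.
have [G Gi G_contr'] : exists2 G : boundedOp E E, forall f, G (i f) = z f &
    forall x, hn (G x) <= 1 * hn x.
  pose z' : {linear fs H X -> E} := HB.pack z (GRing.isLinear.Build _ _ _ _ z z_lin).
  by apply: (@op_ext _ _ E E i z' 1 ler01) => f; rewrite mul1r; exact: (hz f).2.
have G_contr x : hn (G x) <= hn x by rewrite -[leRHS]mul1r.
have GiE f g : rdot (G (i f)) (i g) = kform K f g by rewrite Gi (sdC rd) -(hz f).1.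
have G_sym x y : rdot (G x) y = rdot x (G y).
  apply: (op_dense_sym i_dense) => _ _ [f _ <-] [g _ <-].
  by rewrite (sdC rd (i f)) !GiE kC.
have [KK [T [T_dense TJ T_ext]]] := krein_induced G_sym G_contr.
have /choice[A Ai] a : exists A : boundedOp E E, forall f, A (i f) = i (push_fs phi a f).
  have [c c0 hc] := L_bnd a.
  have [r er] : exists r : R, c = r%:C by apply/complex_realP; rewrite ger0_real.
  rewrite er ler0c in c0.
  have [|B hB _] := @op_ext _ _ E E i (i \o push_fs phi a) r c0; last by exists B.
  move=> f /=; rewrite !i_norm; have := hc _ (fs_fin_supp f).
  rewrite /kernel_seminorm push_fsE !L_real !sqrtC_real ?(sd_ge0 ld)//.
  by rewrite er -rmorphM lecR.
have A_adj a x y : rdot (G (A a x)) y = rdot (G x) (A (a^-1)%g y).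
  have e : (fun x => G (A a x)) =1 (fun x => adjoint (A (a^-1)%g) (G x)).
    apply: (@dense_eq _ _ _ _ _ (fun y => adjoint (A a) (G y))
      (fun y => G (A (a^-1)%g y)) _ _ _ i_dense) => [u v|u v|_ [f _ <-]].
    - by rewrite G_sym adjointP.
    - by rewrite (sdC rd) -adjointP (sdC rd) G_sym.
    apply/eqP; rewrite -subr_eq0; apply/eqP/i_orth => g.
    rewrite (sdBr rd) -adjointP !Ai (sdC rd (i g)) (sdC rd _ (G _)) !GiE.
    by rewrite kform_push subrr.
  by have := e x => /= ->; rewrite (sdC rd) -adjointP (sdC rd).
have /choice[U UT] a : exists U : boundedOp KK KK, forall x, U (T x) = T (A a x).
  exact: (T_ext _ _ (A_adj a)).
have rk := @rdot_semidot R KK.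
have /choice[V hV] x : exists V : boundedOp H KK,
    forall xi, V xi = T (i (single_fs x xi)).
  have [M M0 hM] := boundedOp_bound T; have [N N0 hN] := boundedOp_bound (L x x).
  apply: (@mk_boundedOp _ _ _ (fun xi => T (i (single_fs x xi))) (M * Num.sqrt N)).
    by move=> a u v; rewrite !linearP.
  move=> xi; rewrite (le_trans (hM _))// -mulrA ler_wpM2l// i_norm.
  rewrite -(@ler_pXn2r _ 2)// ?nnegrE ?mulr_ge0 ?sqrtr_ge0 ?snorm_ge0//.
  rewrite (snorm_sqr ld) kform_single exprMn (sqr_sqrtr N0).
  by rewrite (le_trans (sd_le rdot_semidot _ _))// expr2 mulrA ler_wpM2r ?snorm_ge0.
have Ti_dense : hdense (range (T \o i)).
  move=> v e e0; have [M M0 hM] := boundedOp_bound T.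
  have e2 : 0 < e / 2 by rewrite divr_gt0.
  have [_ [u _ <-] hu] := T_dense v _ e2.
  have M1 : 0 < M + 1 by lra.
  have [_ [f _ <-] hf] := i_dense u _ (divr_gt0 e2 M1).
  exists (T (i f)); first by exists f.
  have := snorm_tri rk (T u) v (T (i f)); rewrite -linearB.
  have := hM (u - i f); rewrite ltr_pdivlMr// in hf.
  have := snorm_ge0 rdot (u - i f).
  move: hu hf; move: (hn _) (hn _) (hn _) (hn _) => a b c d; nra.
exists KK, V; split; last first.
  exists U; split; last by move=> a x xi; rewrite !hV UT Ai push_fs_single.
  have U_eq a (W W' : KK -> KK) :
      (forall x y, rdot (W x) y = rdot x (W' y)) ->
      (forall f, U a (T (i f)) = W (T (i f))) -> U a =1 W.
    move=> WW' h; apply: (dense_eq (adjointP (U a)) WW' Ti_dense).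
    by move=> _ [f _ <-]; exact: h.
  split.
  - by apply: (U_eq _ _ id) => // f; rewrite UT Ai push_fs1.
  - move=> a b; apply: (U_eq _ _ (fun y => adjoint (U b) (adjoint (U a) y))).
      by move=> x y; rewrite !adjointP.
    by move=> f; rewrite !UT !Ai push_fsM.
split.
  move=> x y xi; symmetry; apply: adjointE => eta.
  rewrite !hV (sdC rk) TJ GiE kform_single; exact: (sdC rdot_semidot).
apply/hdenseP => v e e0; have [_ [f _ <-] hf] := Ti_dense v e e0.
exists (T (i f)) => //; have [s [us sf _]] := fs_cover f f.
rewrite (fs_decomp us sf) !raddf_sum; apply: lin_span_sum => x.
by exists x => //; exists (val f x) => //; rewrite hV.
Qed.

End Majorant.

(** * From a Kolmogorov decomposition to a reproducing kernel space *)

Section Reproducing.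
Variables (R : realType) (H : hilbertType R[i]) (S : starMonoidType).
Variables (X : choiceType) (phi : S -> X -> X) (K : opkernel H X).
Hypothesis K_inv : forall x y a, K x (phi a y) =1 K (phi (a^-1)%g x) y.
Variables (KK : kreinType R[i]) (V : X -> boundedOp H KK).
Hypothesis VK : kolmogorov_decomposition K V.

(** The value at [x] is the image of [k] under the adjoint of [V x] for the
    indefinite inner product, so that [transform (V x xi)] is a kernel
    section and evaluation is reproduced by kernel sections. *)
Definition transform (k : KK) : X -> H := fun x => adjoint (V x) (fsym k).

Lemma transform_rdot k x xi : rdot (transform k x) xi = rdot (fsym k) (V x xi).
Proof. by rewrite (sdC rdot_semidot) -adjointP (sdC rdot_semidot). Qed.

Lemma transform_linear : linear transform.
Proof.
move=> a k l; apply/funext => x; apply: adjointE => xi.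
rewrite !fctE linearP !(sdDr rdot_semidot) !rdot_conj -linearZ.
by rewrite !adjointP.
Qed.

HB.instance Definition _ := GRing.isLinear.Build R[i] KK (X -> H) _ transform
  transform_linear.

Lemma total_orth (u : KK) : (forall x xi, rdot u (V x xi) = 0) -> u = 0.
Proof.
move=> h; have rd := @rdot_semidot R KK.
apply: (hdense_orth (proj1 (hdenseP _) VK.2)) => _ [n [c [w [hw ->]]]].
rewrite (sdC rd) (sd_suml rd) big1// => i _; rewrite (sdC rd).
by have [x _ [xi _ <-]] := hw i; rewrite -linearZ h.
Qed.

Lemma transform_inj : injective transform.
Proof.
move=> k l kl; apply/eqP; rewrite -subr_eq0; apply/eqP.
apply: (can_inj fsymK); rewrite linear0; apply: total_orth => x xi.
have e : transform (k - l) = 0 by rewrite linearB /= kl subrr.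
by rewrite -transform_rdot e (sd0l rdot_semidot).
Qed.

Lemma kernel_section_transform x xi : kernel_section K x xi = transform (V x xi).
Proof. by apply/funext => y; rewrite /kernel_section VK.1. Qed.

Local Notation RR := (krange transform_inj).

(** The representation is carried over by [transform]; it acts on functions by
    translation because [U a] and [U a^-1] are adjoint to each other. *)
Lemma reproducing_space (U : S -> boundedOp KK KK) : is_representation U ->
  (forall a x xi, V (phi a x) xi = U a (V x xi)) ->
  exists (D : pred (X -> H)) (RR : subKreinType D)
         (gD : forall x xi, D (kernel_section K x xi)),
    let g x xi : RR := Sub (kernel_section K x xi) (gD x xi) in
    [/\ total_set [set g x xi | x in [set: X] & xi in [set: H]],
        forall (f : RR) xi x, hdot (val f x) xi = kdot f (g x xi) &
        exists U : S -> boundedOp RR RR,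
          is_representation U /\
          forall a x f, val (U a f) x = val f (phi (a^-1)%g x)].
Proof.
move=> [U1 UM] UV; have rd := @rdot_semidot R KK.
have gD x xi : krange_pred transform (kernel_section K x xi).
  by rewrite kernel_section_transform; exact: in_krange.
exists (krange_pred transform), RR, gD => g.
have gE x xi : g x xi = to_krange transform_inj (V x xi).
  by apply/val_inj; rewrite SubK val_to_krange kernel_section_transform.
split.
- apply/hdenseP => f e e0.
  have [_ [n [c [w [hw ->]]]] h] := proj1 (hdenseP _) VK.2 (kcoord f) e e0.
  exists (to_krange transform_inj (\sum_(i < n) c i *: w i)); last first.
    by rewrite hn_krange linearB /= to_krangeK.
  exists n, c, (fun i => to_krange transform_inj (w i)); split; last first.
    by rewrite linear_sum; apply: eq_bigr => i _; rewrite linearZ.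
  move=> i; have [x _ [xi _ <-]] := hw i.
  by exists x => //; exists xi => //; rewrite gE.
- move=> f xi x; rewrite kdot_krange gE to_krangeK -kcoordK /kdot.
  rewrite !rdotE /cdot !transform_rdot linearZ.
  by [].
have /choice[U' hU'] a := krange_op transform_inj (U a).
exists U'; split; first split.
- by move=> f; apply: (@kcoord_inj _ _ _ _ transform_inj); rewrite hU' to_krangeK U1.
- move=> a b f; apply: (@kcoord_inj _ _ _ _ transform_inj).
  by rewrite !hU' !to_krangeK UM.
move=> a x f; rewrite hU' val_to_krange -kcoordK; apply: adjointE => xi.
set k := kcoord f.
rewrite [RHS](sdC rdot_semidot) transform_rdot UV -fsym_sym (sdC rd) adjointP.
rewrite fsym_sym.
(* [U a] and [U a^-1] are adjoint for the indefinite inner product, by the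
   invariance of [K] on the total set. *)
congr (rdot _ _); apply/eqP; rewrite -subr_eq0; apply/eqP/total_orth => y eta.
rewrite (sdBl rd) (sdC rd (adjoint _ _)) -adjointP (sdC rd (U a _)) -!UV -!transform_rdot.
by rewrite -!kernel_section_transform /kernel_section K_inv invgK subrr.
Qed.

End Reproducing.

(** * From a reproducing kernel space to a majorant *)

Lemma kernel_form_gram (R : realType) (H E : hilbertType R[i]) (X : choiceType)
    (K : opkernel H X) (v : X -> {linear H -> E}) (B : {linear E -> E}) :
  (forall x y xi eta, hdot (K x y xi) eta = hdot (B (v y xi)) (v x eta)) ->
  forall f g : fs H X,
  kernel_form K (val f) (val g) = hdot (B (fs_sum v f)) (fs_sum v g).
Proof.
move=> Kv f g; have [s [us sf sg]] := fs_cover f g.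
rewrite (kernel_formE _ us)// !(fs_sumE _ us)// linear_sumr.
apply: eq_bigr => x _; rewrite linear_sum linear_sumlz.
by apply: eq_bigr => y _; rewrite Kv.
Qed.

Section Converse.
Variables (R : realType) (H : hilbertType R[i]) (S : starMonoidType).
Variables (X : choiceType) (phi : S -> X -> X) (K : opkernel H X).
Hypothesis K_inv : forall x y a, K x (phi a y) =1 K (phi (a^-1)%g x) y.
Variables (D : pred (X -> H)) (RR : subKreinType D).
Variable gD : forall x xi, D (kernel_section K x xi).
Let g x xi : RR := Sub (kernel_section K x xi) (gD x xi).
Hypothesis g_rep : forall (f : RR) xi x, hdot (val f x) xi = kdot f (g x xi).
Variable U : S -> boundedOp RR RR.
Hypothesis U_val : forall a x f, val (U a f) x = val f (phi (a^-1)%g x).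

Let g_val x xi : val (g x xi) = kernel_section K x xi.
Proof. exact: SubK. Qed.

Let val_lin (a : R[i]) (f f' : RR) : val (a *: f + f') = a *: val f + val f'.
Proof. exact: linearP. Qed.

Let g_linear x : linear (g x).
Proof.
move=> a u v; apply/val_inj; rewrite val_lin !g_val; apply/funext => y.
by rewrite /kernel_section !fctE linearP.
Qed.

Let gl x : {linear H -> RR} := HB.pack (g x) (GRing.isLinear.Build _ _ _ _ (g x) (g_linear x)).

Let U_g a x xi : U a (g x xi) = g (phi a x) xi.
Proof.
apply/val_inj/funext => y; rewrite U_val !g_val /kernel_section.
by rewrite K_inv.
Qed.

Let g_rdot (f : RR) x xi : rdot (val f x) xi = rdot (fsym f) (g x xi).
Proof. by rewrite /rdot g_rep. Qed.

(** The majorant is the Gram kernel of the kernel sections for the Hilbert inner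
    product of [RR]. It dominates [K] because the fundamental symmetry is
    isometric, it is [phi]-bounded because [U a] maps [g x xi] to
    [g (phi a x) xi], and its values are bounded by [hellinger_toeplitz]. *)
Lemma reproducing_majorant : exists L : opkernel H X,
  [/\ posdef_bounded phi L, le_kernel (opp_kernel L) K & le_kernel K L].
Proof.
have rd := @rdot_semidot R RR.
have /choice[L0 hL0] (xy : X * X) : exists A : boundedOp H H,
    A =1 (fun xi => val (fsym (g xy.2 xi)) xy.1).
  have h x y xi eta : rdot (val (fsym (g y xi)) x) eta = rdot xi (val (fsym (g x eta)) y).
    by rewrite (sdC rdot_semidot xi) !g_rdot !fsymK (sdC rd).
  apply: (@hellinger_toeplitz _ _ _ _ (fun eta => val (fsym (g xy.1 eta)) xy.2)) => //.
  by move=> a u v; rewrite g_linear linearP val_lin.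
pose L : opkernel H X := fun x y => L0 (x, y).
have hL x y xi : L x y xi = val (fsym (g y xi)) x by rewrite /L hL0.
have L_rdot x y xi eta : rdot (L x y xi) eta = rdot (g y xi) (g x eta).
  by rewrite hL g_rdot fsymK.
have L_gram x y xi eta : hdot (L x y xi) eta = hdot (gl y xi) (gl x eta).
  by rewrite hL g_rep /kdot fsymK.
have K_gram x y xi eta : hdot (K x y xi) eta = hdot (fsym (gl y xi)) (gl x eta).
  by rewrite -[LHS]/(hdot (kernel_section K y xi x) eta) -g_val g_rep.
have L_form (f f' : fs H X) :
    kernel_form L (val f) (val f') = hdot (fs_sum gl f) (fs_sum gl f').
  exact: (@kernel_form_gram _ _ _ _ _ gl idfun).
have K_form (f f' : fs H X) :
    kernel_form K (val f) (val f') = hdot (fsym (fs_sum gl f)) (fs_sum gl f').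
  exact: (@kernel_form_gram _ _ _ _ _ gl fsym).
have L_real (u : RR) : hdot u u = (rdot u u)%:C.
  by rewrite rdotE /cdot (sd_ix rd).
have K_real (u : RR) : hdot (fsym u) u = (rdot (fsym u) u)%:C.
  rewrite rdotE /cdot; congr (_ +i* _).
  have := fsym_sym u ('i *: u); rewrite linearZ (sdC rd u) (sd_il rd).
  by move: (rdot _ _) => r; lra.
have K_le (u : RR) : `|rdot (fsym u) u| <= rdot u u.
  by rewrite (le_trans (sd_cauchy rd _ _))// fsym_norm -expr2 (snorm_sqr rd).
exists L; split.
- split; first split.
  + move=> x y xi; symmetry; apply: adjointE => eta.
    by rewrite (sdC rdot_semidot eta) !L_rdot (sdC rd).
  + move=> _ /fs_of[f <-]; rewrite L_form L_real ler0c.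
    exact: (sd_ge0 rd).
  move=> a; have [M M0 hM] := boundedOp_bound (U a).
  exists M%:C; first by rewrite ler0c.
  move=> _ /fs_of[f <-]; rewrite /kernel_seminorm push_fsE !L_form !L_real.
  rewrite !sqrtC_real ?(sd_ge0 rd)// -rmorphM lecR.
  suff -> : fs_sum gl (push_fs phi a f) = U a (fs_sum gl f) by exact: hM.
  elim/fs_ind: f => [|f f' IH IH'|x xi]; first by rewrite !linear0.
    by rewrite !linearD /= IH IH'.
  by rewrite push_fs_single !fs_sum_single -[LHS]U_g.
- move=> _ /fs_of[f <-].
  rewrite (@kernel_form_gram _ _ _ _ _ gl (-%R)) => [|x y xi eta]; last first.
    by rewrite /opp_kernel /= !linearNl; congr (- _); exact: L_gram.
  rewrite K_form K_real [leLHS](_ : _ = (- rdot (fs_sum gl f) (fs_sum gl f))%:C).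
    by rewrite lecR; have := K_le (fs_sum gl f); rewrite ler_norml => /andP[].
  by rewrite /= rdotE /cdot !(sdNl rd) (sd_ix rd) oppr0.
- move=> _ /fs_of[f <-]; rewrite L_form K_form L_real K_real lecR.
  exact: le_trans (ler_norm _) (K_le _).
Qed.

End Converse.

Theorem theorem2p4 (R : realType) (H : hilbertType R[i]) (S : starMonoidType)
    (X : choiceType) (phi : S -> X -> X) (K : opkernel H X) :
  is_action phi ->
  hermitian_kernel K ->
  (forall x y a, K x (phi a y) =1 K (phi (a^-1)%g x) y) ->
  [<->
    exists L : opkernel H X,
      [/\ posdef_bounded phi L, le_kernel (opp_kernel L) K & le_kernel K L];

    exists (KK : kreinType R[i]) (V : X -> boundedOp H KK),
      kolmogorov_decomposition K V /\
      exists U : S -> boundedOp KK KK,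
        is_representation U /\
        forall a x xi, V (phi a x) xi = U a (V x xi);

    exists (D : pred (X -> H)) (RR : subKreinType D)
           (gD : forall x xi, D (kernel_section K x xi)),
      let g x xi : RR := Sub (kernel_section K x xi) (gD x xi) in
      [/\ total_set [set g x xi | x in [set: X] & xi in [set: H]],
          forall (f : RR) xi x, hdot (val f x) xi = kdot f (g x xi) &
          exists U : S -> boundedOp RR RR,
            is_representation U /\
            forall a x f, val (U a f) x = val f (phi (a^-1)%g x)]].
Proof.
move=> phi_act K_herm K_inv.
tfae.
- by move=> [L [L_pos LK KL]]; exact: (majorant_kolmogorov phi_act K_herm K_inv L_pos LK KL).
- by move=> [KK [V [VK [U [U_rep UV]]]]]; exact: (reproducing_space K_inv VK U_rep UV).
- move=> [D [RR [gD [_ g_rep [U [_ U_val]]]]]].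
  exact: (reproducing_majorant K_inv g_rep U_val).
Qed.
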